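(* Let $q\in\mathbb{C}^{\times}$ be not a root of unity. Then the Nichols algebra $B(V)$ is generated by the Chevalley generators $X_1=x_1$ and $Y_1=x_2$ with the quantum Serre relations as defining relations: the kernel of the canonical surjection $T(V)\to B(V)$ is the two-sided ideal generated by $$[x_1,[x_1,[x_1,x_2]]]\quad\text{and}\quad [[[x_1,x_2],x_2],x_2].$$ Consequently $B(V)$ and $U_{v}(A(0,2)^{(4)})^{+}$ are isomorphic, where $q=v^2$.
   Context: Let $V$ be the two-dimensional complex vector space with basis $x_1,x_2$ and braiding of diagonal type $c(x_i\otimes x_j)=q_{ij}\,x_j\otimes x_i$, where $q_{11}=q$, $q_{12}=q_{21}=q^{-1}$, $q_{22}=-q$. Let $\alpha_1,\alpha_2$ be the standard basis of $\mathbb{Z}^2$ and $\chi:\mathbb{Z}^2\times\mathbb{Z}^2\to\mathbb{C}^\times$ the bicharacter with $\chi(\alpha_i,\alpha_j)=q_{ij}$. The tensor algebra $T(V)$ is a braided Hopf algebra with $x_1,x_2$ primitive and is $\mathbb{N}_0^2$-graded by $\deg x_i=\alpha_i$. The Nichols algebra $B(V)$ is the quotient of $T(V)$ by the largest coideal among the ideals contained in $\bigoplus_{n\ge2}V^{\otimes n}$ (it is an $\mathbb{N}_0^2$-graded braided Hopf algebra). The braided bracket is $[x,y]=xy-\chi(\deg x,\deg y)\,yx$ for homogeneous $x,y$, extended bilinearly. $U_v(A(0,2)^{(4)})^+$ denotes the positive part of the quantum affine superalgebra of type $A(0,2)^{(4)}$ (Cartan matrix $\begin{pmatrix}2&-2\\-2&2\end{pmatrix}$,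 $\alpha_1$ even, $\alpha_2$ odd), defined by quantum Serre relations, i.e. the algebra generated by two generators $x_1,x_2$ subject to the relations $[x_1,[x_1,[x_1,x_2]]]=0$ and $[[[x_1,x_2],x_2],x_2]=0$, with the bracket above and $q=v^2$. *)

(* Defs.v *)
From HB Require Import structures.
From mathcomp Require Import all_boot all_order all_algebra.
From mathcomp Require Import finmap.
From mathcomp.multinomials Require Import monalg.
From mathcomp Require Import boolp reals complex.

Set Implicit Arguments.
Unset Strict Implicit.
Unset Printing Implicit Defensive.

Import GRing.Theory.

Local Open Scope ring_scope.

(* Two-sided ideals, ideals generated by a family, and quotients of a
   (noncommutative) algebra by a proper two-sided ideal.  MathComp only
   provides ring quotients of commutative rings. *)
Section TwoSidedIdeals.
Variables (F : fieldType) (A : algType F).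
Implicit Types (I : A -> Prop) (a b c : A).

Definition is_ideal I : Prop :=
  [/\ I 0,
      forall a b, I a -> I b -> I (a + b),
      forall a b, I b -> I (a * b)
    & forall a b, I a -> I (a * b)].

Definition generated_ideal (s : seq A) a : Prop :=
  forall I, is_ideal I -> (forall r, r \in s -> I r) -> I a.

Lemma generated_ideal_is_ideal s : is_ideal (generated_ideal s).
Proof.
split=> [I [] //|a b Ia Ib J JP sJ|a b Ib J JP sJ|a b Ia J JP sJ].
- by case: (JP) => _ JD _ _; apply: JD; [exact: Ia|exact: Ib].
- by case: (JP) => _ _ JM _; apply: JM; exact: Ib.
- by case: (JP) => _ _ _ JM; apply: JM; exact: Ia.
Qed.

Record proper_ideal2 := ProperIdeal2 {
  ideal2_carrier :> A -> Prop;
  ideal2P : is_ideal ideal2_carrier;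
  ideal2_proper : ~ ideal2_carrier 1
}.

End TwoSidedIdeals.

Section AlgebraQuotient.
Variables (F : fieldType) (A : algType F) (I : proper_ideal2 A).

Definition ideal2_pred : {pred A} := fun a => `[< I a >].

Lemma ideal2_zmod_closed : zmod_closed ideal2_pred.
Proof.
case: (ideal2P I) => I0 ID IM _; split; first exact/asboolP.
move=> a b /asboolP Ia /asboolP Ib; apply/asboolP/ID => //.
by rewrite -mulN1r; exact: IM.
Qed.
HB.instance Definition _ := GRing.isZmodClosed.Build A ideal2_pred
  ideal2_zmod_closed.

Definition alg_quot := Quotient.quot ideal2_pred.

HB.instance Definition _ := GRing.Zmodule.on alg_quot.

Definition alg_pr (a : A) : alg_quot := \pi_alg_quot%qT a.

Lemma alg_prP a b : reflect (I (a - b)) (alg_pr a == alg_pr b).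
Proof.
apply: (iffP idP).
  by rewrite /alg_pr -Quotient.idealrBE => /asboolP.
by move=> Iab; rewrite /alg_pr -Quotient.idealrBE; exact/asboolP.
Qed.

Lemma alg_pr_repr (x : alg_quot) : alg_pr (repr x) = x.
Proof. exact: reprK. Qed.

Lemma alg_prI a : I (repr (alg_pr a) - a).
Proof. by apply/alg_prP; rewrite alg_pr_repr. Qed.

Lemma alg_prB : {morph alg_pr : a b / a - b}.
Proof. by move=> a b; rewrite /alg_pr raddfB. Qed.
HB.instance Definition _ := GRing.isZmodMorphism.Build A alg_quot alg_pr alg_prB.

Definition alg_quot_one : alg_quot := alg_pr 1.
Definition alg_quot_mul (x y : alg_quot) : alg_quot := alg_pr (repr x * repr y).
Definition alg_quot_scale (c : F) (x : alg_quot) : alg_quot :=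
  alg_pr (c *: repr x).

Lemma alg_prM a b : alg_pr (a * b) = alg_quot_mul (alg_pr a) (alg_pr b).
Proof.
apply/esym/eqP/alg_prP; case: (ideal2P I) => I0 ID IM1 IM2.
rewrite -[repr (alg_pr a) * _](subrK (a * repr (alg_pr b))).
rewrite -addrA -mulrBl -mulrBr; apply: ID; first by apply: IM2; exact: alg_prI.
by apply: IM1; exact: alg_prI.
Qed.

Lemma alg_prZ c a : alg_pr (c *: a) = alg_quot_scale c (alg_pr a).
Proof.
apply/esym/eqP/alg_prP; case: (ideal2P I) => I0 ID IM1 IM2.
by rewrite -scalerBr -mulr_algl; apply: IM1; exact: alg_prI.
Qed.

Let quotE (x : alg_quot) : exists a, x = alg_pr a.
Proof. by exists (repr x); rewrite alg_pr_repr. Qed.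

Fact alg_quot_mulA : associative alg_quot_mul.
Proof.
move=> x y z; have [[[a ->] [b ->]] [c ->]] := (quotE x, quotE y, quotE z).
by rewrite -!alg_prM mulrA.
Qed.

Fact alg_quot_mul1x : left_id alg_quot_one alg_quot_mul.
Proof. by move=> x; have [a ->] := quotE x; rewrite -alg_prM mul1r. Qed.

Fact alg_quot_mulx1 : right_id alg_quot_one alg_quot_mul.
Proof. by move=> x; have [a ->] := quotE x; rewrite -alg_prM mulr1. Qed.

Fact alg_quot_mulDl : left_distributive alg_quot_mul +%R.
Proof.
move=> x y z; have [[[a ->] [b ->]] [c ->]] := (quotE x, quotE y, quotE z).
by rewrite -raddfD -!alg_prM mulrDl raddfD.
Qed.

Fact alg_quot_mulDr : right_distributive alg_quot_mul +%R.
Proof.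
move=> x y z; have [[[a ->] [b ->]] [c ->]] := (quotE x, quotE y, quotE z).
by rewrite -raddfD -!alg_prM mulrDr raddfD.
Qed.

Fact alg_quot_one_neq0 : alg_quot_one != 0.
Proof.
apply/eqP; rewrite /alg_quot_one -(raddf0 alg_pr) => /eqP/alg_prP.
by rewrite subr0; exact: ideal2_proper.
Qed.

HB.instance Definition _ := GRing.Zmodule_isNzRing.Build alg_quot
  alg_quot_mulA alg_quot_mul1x alg_quot_mulx1 alg_quot_mulDl alg_quot_mulDr
  alg_quot_one_neq0.

Fact alg_quot_scaleA a b x :
  alg_quot_scale a (alg_quot_scale b x) = alg_quot_scale (a * b) x.
Proof. by have [c ->] := quotE x; rewrite -!alg_prZ scalerA. Qed.

Fact alg_quot_scale1 : left_id 1 alg_quot_scale.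
Proof. by move=> x; have [c ->] := quotE x; rewrite -!alg_prZ scale1r. Qed.

Fact alg_quot_scaleDr : right_distributive alg_quot_scale +%R.
Proof.
move=> a x y; have [[b ->] [c ->]] := (quotE x, quotE y).
by rewrite -raddfD -!alg_prZ scalerDr raddfD.
Qed.

Fact alg_quot_scaleDl x : {morph alg_quot_scale^~ x : a b / a + b}.
Proof.
by move=> a b; have [c ->] := quotE x; rewrite -!alg_prZ scalerDl raddfD.
Qed.

HB.instance Definition _ := GRing.Zmodule_isLmodule.Build F alg_quot
  alg_quot_scaleA alg_quot_scale1 alg_quot_scaleDr alg_quot_scaleDl.

Fact alg_quot_scaleAl a x y :
  alg_quot_scale a (alg_quot_mul x y) = alg_quot_mul (alg_quot_scale a x) y.
Proof.
have [[b ->] [c ->]] := (quotE x, quotE y).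
by rewrite -alg_prM -!alg_prZ -alg_prM scalerAl.
Qed.

Fact alg_quot_scaleAr a x y :
  alg_quot_scale a (alg_quot_mul x y) = alg_quot_mul x (alg_quot_scale a y).
Proof.
have [[b ->] [c ->]] := (quotE x, quotE y).
by rewrite -alg_prM -!alg_prZ -alg_prM scalerAr.
Qed.

HB.instance Definition _ := GRing.Lmodule_isLalgebra.Build F alg_quot
  alg_quot_scaleAl.
HB.instance Definition _ := GRing.Lalgebra_isAlgebra.Build F alg_quot
  alg_quot_scaleAr.

Fact alg_pr_monoid_morphism : monoid_morphism alg_pr.
Proof. by split=> // a b; rewrite alg_prM. Qed.
HB.instance Definition _ := GRing.isMonoidMorphism.Build A alg_quot alg_pr
  alg_pr_monoid_morphism.

Fact alg_pr_scalable : scalable alg_pr.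
Proof. by move=> c a; rewrite alg_prZ. Qed.
HB.instance Definition _ := GRing.isScalable.Build F A alg_quot *:%R alg_pr
  alg_pr_scalable.

Lemma alg_pr_eq0 a : alg_pr a = 0 <-> I a.
Proof.
rewrite -(raddf0 alg_pr); split=> [/eqP/alg_prP|Ia]; first by rewrite subr0.
by apply/eqP/alg_prP; rewrite subr0.
Qed.

End AlgebraQuotient.

Definition is_subalgebra (F : fieldType) (A : algType F) (P : A -> Prop) :=
  [/\ P 1, forall a b, P a -> P b -> P (a + b),
      forall a b, P a -> P b -> P (a * b)
    & forall (c : F) a, P a -> P (c *: a)].

Definition generates_algebra (F : fieldType) (A : algType F) (s : seq A) :=
  forall P : A -> Prop, is_subalgebra P -> (forall x, x \in s -> P x) ->
  forall a, P a.

Section LinearExtension.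
Variables (F : fieldType) (K : choiceType) (M : lmodType F) (h : K -> M).

Definition linext (g : {malg F[K]}) : M := \sum_(k <- msupp g) g@_k *: h k.

Lemma linextEw (d : {fset K}) g : (msupp g `<=` d)%fset ->
  linext g = \sum_(k <- d) g@_k *: h k.
Proof.
move=> gd; rewrite /linext (big_fset_incl _ gd) //= => k _ /mcoeff_outdom ->.
by rewrite scale0r.
Qed.

Lemma linext_is_linear : linear linext.
Proof.
move=> c g1 g2; pose d := (msupp g1 `|` msupp g2)%fset.
have d1 : (msupp g1 `<=` d)%fset by exact: fsubsetUl.
have d2 : (msupp g2 `<=` d)%fset by exact: fsubsetUr.
have dZ : (msupp (c *: g1) `<=` d)%fset := fsubset_trans (msuppZ_le c g1) d1.
have d3 : (msupp (c *: g1 + g2) `<=` d)%fset.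
  by apply: fsubset_trans (msuppD_le _ _) _; rewrite fsubUset dZ d2.
rewrite (linextEw d1) (linextEw d2) (linextEw d3) scaler_sumr -big_split /=.
by apply: eq_bigr => k _; rewrite mcoeffD mcoeffZ scalerDl scalerA.
Qed.
HB.instance Definition _ := GRing.isLinear.Build F {malg F[K]} M *:%R linext
  linext_is_linear.

Lemma linextU k : linext << k >> = h k.
Proof. by rewrite /linext msuppU oner_eq0 big_seq_fset1 mcoeffUU scale1r. Qed.

End LinearExtension.

Section TensorAlgebra.
Variables (F : fieldType) (n : nat).

(* T(V) for V with basis x_0, ..., x_(n-1): the free algebra, i.e. the monoid
   algebra of the free monoid of words in the basis. *)
Definition tensor_alg := {malg F[{fmonom 'I_n}]}.
HB.instance Definition _ := GRing.Lalgebra.on tensor_alg.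

Fact tensor_alg_scaleAr (c : F) (a b : tensor_alg) : c *: (a * b) = a * (c *: b).
Proof.
rewrite [a * b]malgME [a * (c *: b)](malgMEw (fsubset_refl _) (msuppZ_le c b)).
rewrite scaler_sumr; apply: eq_bigr => u _; rewrite scaler_sumr.
apply: eq_bigr => w _; apply/malgP => k.
by rewrite !(mcoeffZ, mcoeffU) mulrnAr mulrCA.
Qed.
HB.instance Definition _ := GRing.Lalgebra_isAlgebra.Build F tensor_alg
  tensor_alg_scaleAr.

Definition tgen (i : 'I_n) : tensor_alg := << fmu i >>.

(* T(V) (x) T(V), with the pure tensors of words as basis. *)
Definition tensor_alg2 := {malg F[({fmonom 'I_n} * {fmonom 'I_n})%type]}.
HB.instance Definition _ := GRing.Lmodule.on tensor_alg2.

Definition tens (a b : tensor_alg) : tensor_alg2 :=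
  linext (fun u => linext (fun w => << (u, w) >> : tensor_alg2) b) a.

Definition wdeg (w : {fmonom 'I_n}) : 'rV[int]_n :=
  \row_i (count_mem i w)%:Z.

Definition counit (a : tensor_alg) : F := a@_mone.

Definition degree_ge2 (a : tensor_alg) : Prop :=
  forall w, w \in msupp a -> (2 <= fdeg w)%N.

(* The subspace I (x) T(V) + T(V) (x) I of T(V) (x) T(V). *)
Definition coideal_span (I : tensor_alg -> Prop) (z : tensor_alg2) : Prop :=
  exists2 s : seq (tensor_alg * tensor_alg),
    (forall p, p \in s -> I p.1 \/ I p.2) & z = \sum_(p <- s) tens p.1 p.2.

End TensorAlgebra.

Section Braided.
Variables (F : fieldType) (n : nat) (q : 'M[F]_n).
Local Notation T := (tensor_alg F n).
Local Notation T2 := (tensor_alg2 F n).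
Implicit Types (a b : T) (z t : T2) (I : T -> Prop).

Definition bichar (al be : 'rV[int]_n) : F :=
  \prod_i \prod_j q i j ^ (al 0 i * be 0 j).

Definition bracket a b : T :=
  linext (fun u => linext (fun w =>
    << u >> * << w >> - bichar (wdeg u) (wdeg w) *: (<< w >> * << u >>) : T)
  b) a.

(* (u (x) u') (w (x) w') = chi(deg u', deg w) uw (x) u'w', the multiplication
   of T(V) (x) T(V) twisted by the braiding c(x_i (x) x_j) = q_ij x_j (x) x_i. *)
Definition braided_mul z t : T2 :=
  linext (fun p => linext (fun r =>
    bichar (wdeg p.2) (wdeg r.1) *:
      << (mmul p.1 r.1, mmul p.2 r.2) >> : T2)
  t) z.

(* The algebra morphism T(V) -> T(V) (x) T(V) for which the x_i are primitive. *)
Definition comult_word (w : {fmonom 'I_n}) : T2 :=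
  foldr (fun i z => braided_mul (tens (tgen F i) 1 + tens 1 (tgen F i)) z)
    (tens 1 1) w.

Definition comult a : T2 := linext comult_word a.

Definition is_coideal I : Prop :=
  (forall a, I a -> counit a = 0) /\
  (forall a, I a -> coideal_span I (comult a)).

Definition nichols_candidate I : Prop :=
  [/\ is_ideal I, is_coideal I & forall a, I a -> degree_ge2 a].

(* The largest candidate, obtained as the union of all of them: see
   nichols_ideal_max and nichols_ideal_candidate. *)
Definition nichols_ideal a : Prop := exists2 I, nichols_candidate I & I a.

Lemma nichols_ideal_max I : nichols_candidate I ->
  forall a, I a -> nichols_ideal a.
Proof. by move=> IP a Ia; exists I. Qed.

Let sumI (I J : T -> Prop) c := exists a b, [/\ I a, J b & c = a + b].

Let sumI_candidate I J : nichols_candidate I -> nichols_candidate J ->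
  nichols_candidate (sumI I J).
Proof.
move=> [[I0 ID IMl IMr] [Ie Ic] I2] [[J0 JD JMl JMr] [Je Jc] J2].
have subI a : I a -> sumI I J a by move=> Ia; exists a, 0; rewrite addr0.
have subJ a : J a -> sumI I J a by move=> Ja; exists 0, a; rewrite add0r.
split; last 1 first.
- move=> _ [a [b [Ia Jb ->]]] w /(fsubsetP (msuppD_le _ _)).
  by rewrite in_fsetU => /orP[/(I2 _ Ia)|/(J2 _ Jb)].
- split; first exact: subI.
  + move=> _ _ [a [b [Ia Jb ->]]] [c [d [Ic' Jd ->]]].
    by exists (a + c), (b + d); rewrite addrACA; split; [exact: ID|exact: JD|].
  + move=> c _ [a [b [Ia Jb ->]]].
    by exists (c * a), (c * b); rewrite mulrDr; split; [exact: IMl|exact: JMl|].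
  + move=> _ c [a [b [Ia Jb ->]]].
    by exists (a * c), (b * c); rewrite mulrDl; split; [exact: IMr|exact: JMr|].
- split=> _ [a [b [Ia Jb ->]]].
    by rewrite /counit mcoeffD; move: (Ie _ Ia) (Je _ Jb);
       rewrite /counit => -> ->; rewrite addr0.
  have [s sI sE] := Ic _ Ia; have [t tJ tE] := Jc _ Jb.
  exists (s ++ t); last by rewrite big_cat /= /comult raddfD /= -sE -tE.
  move=> p; rewrite mem_cat => /orP[/sI|/tJ] [].
  + by move/subI; left.
  + by move/subI; right.
  + by move/subJ; left.
  + by move/subJ; right.
Qed.

Lemma nichols_ideal_candidate : nichols_candidate nichols_ideal.
Proof.
split; last by move=> a [I [_ _ I2] /I2].
- split.
  + exists (eq 0) => //; split.
    * split=> // [a b <- <-|a b <-|a b <-]; first by rewrite addr0.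
        by rewrite mulr0.
      by rewrite mul0r.
    * split=> a <-; first exact: mcoeff0.
      by exists [::]; rewrite // big_nil /comult raddf0.
    * by move=> a <- w; rewrite msupp0.
  + move=> a b [I IP Ia] [J JP Jb]; exists (sumI I J).
      exact: sumI_candidate.
    by exists a, b.
  + by move=> a b [I IP Ib]; exists I => //; case: IP => [[_ _ IM _] _ _]; apply: IM.
  + by move=> a b [I IP Ia]; exists I => //; case: IP => [[_ _ _ IM] _ _]; apply: IM.
- split=> a [I IP Ia]; case: (IP) => _ [Ie Ic] _; first exact: Ie.
  have [s sI ->] := Ic _ Ia; exists s => // p /sI [Ip|Ip]; [left|right];
  exact: nichols_ideal_max Ip.
Qed.

Lemma nichols_ideal_proper : ~ nichols_ideal 1.
Proof.
case=> I [_ [Ie _] _] /Ie; rewrite /counit => /eqP.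
by rewrite [1@__](mcoeffUU _ 1) oner_eq0.
Qed.

Definition nichols_proper_ideal : proper_ideal2 T :=
  ProperIdeal2 (let: And3 IP _ _ := nichols_ideal_candidate in IP)
    nichols_ideal_proper.

Definition nichols_alg := alg_quot nichols_proper_ideal.
HB.instance Definition _ := GRing.Algebra.on nichols_alg.

(* The canonical surjection T(V) -> B(V). *)
Definition nichols_pr : T -> nichols_alg := @alg_pr F T nichols_proper_ideal.
HB.instance Definition _ := GRing.LRMorphism.on nichols_pr.

Lemma counit_bracket a b : counit (bracket a b) = 0.
Proof.
rewrite /counit /bracket {1}/linext raddf_sum big1 // => u _.
rewrite /linext scaler_sumr raddf_sum big1 // => w _.
rewrite /= 2!mcoeffZ mcoeffB mcoeffZ !rmorphM /= !mcoeffU.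
have [->|_] := eqVneq u mone; last by rewrite mul0r mulr0 mulr0 subrr !mulr0.
have [->|_] := eqVneq w mone; last by rewrite mul0r mulr0 mulr0 subrr !mulr0.
rewrite /bichar big1 ?mul1r ?subrr ?mulr0 // => i _; rewrite big1 // => j _.
by rewrite !mxE fm1 mulr0 expr0z.
Qed.

End Braided.

Section RankTwo.
Variable F : fieldType.

(* q_11 = q, q_12 = q_21 = q^-1, q_22 = -q; indices of 'I_2 start at 0. *)
Definition braiding_matrix (q : F) : 'M[F]_2 :=
  \matrix_(i, j) if i != j then q^-1 else if i == 0 then q else - q.

Definition x1 : tensor_alg F 2 := tgen F 0.
Definition x2 : tensor_alg F 2 := tgen F 1.

Definition serre_relations (q : F) : seq (tensor_alg F 2) :=
  let br := bracket (braiding_matrix q) in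
  [:: br x1 (br x1 (br x1 x2)); br (br (br x1 x2) x2) x2].

Definition serre_ideal (q : F) : tensor_alg F 2 -> Prop :=
  generated_ideal (serre_relations q).

Lemma serre_ideal_proper q : ~ serre_ideal q 1.
Proof.
move=> /(_ (fun a => counit a = 0)) I1.
suff: counit (1 : tensor_alg F 2) = 0.
  by rewrite /counit [1@__](mcoeffUU _ 1) => /eqP; rewrite oner_eq0.
apply: I1.
  rewrite /counit; split=> [|a b a0 b0|a b b0|a b a0]; first exact: mcoeff0.
  - by rewrite mcoeffD a0 b0 addr0.
  - by rewrite [LHS](rmorphM (mcoeff mone)) /= b0 mulr0.
  - by rewrite [LHS](rmorphM (mcoeff mone)) /= a0 mul0r.
by move=> r; rewrite !inE => /orP[] /eqP ->; exact: counit_bracket.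
Qed.

Definition serre_proper_ideal (q : F) : proper_ideal2 (tensor_alg F 2) :=
  ProperIdeal2 (generated_ideal_is_ideal (serre_relations q))
    (@serre_ideal_proper q).

(* U_v(A(0,2)^(4))^+, the deformation parameter of the relations being v^2. *)
Definition Uplus (v : F) := alg_quot (serre_proper_ideal (v ^+ 2)).
HB.instance Definition _ v := GRing.Algebra.on (Uplus v).

Definition Uplus_pr (v : F) : tensor_alg F 2 -> Uplus v :=
  @alg_pr F _ (serre_proper_ideal (v ^+ 2)).
HB.instance Definition _ v := GRing.LRMorphism.on (Uplus_pr v).

End RankTwo.

(* Main.v *)
Require Import Defs.
From HB Require Import structures.
From mathcomp Require Import all_boot all_order all_algebra.
From mathcomp Require Import finmap.
From mathcomp.multinomials Require Import monalg.
From mathcomp Require Import reals complex.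
From mathcomp Require Import ring zify.

Set Implicit Arguments.
Unset Strict Implicit.
Unset Printing Implicit Defensive.

Import Order.TTheory GRing.Theory Num.Theory.

Local Open Scope ring_scope.

(** Let J be the ideal of the Serre relations and N the Nichols ideal; the
theorem amounts to J = N.

J is contained in N.  Both relations are values of the iterated braided adjoint
action, ad(x_i)^3 (x_j) (iter_radx_eq_adx for the one that is written with
right brackets).  Because q_ii^2 q_ij q_ji = 1, these elements are primitive
(serre_primitive), so the ideal that they generate is a coideal (J_coideal) and
lives in degrees at least 2.

N is contained in J.  Go by induction on the total degree and let u be the
component of degree d = (d_0, d_1) of an element of N.  The skew derivations of
u are components of elements of N, so they lie in J by induction: modulo J, the
element u is primitive.  Two arguments then force u into J.

- If d_0 and d_1 differ, let i be the index of the larger one.  The adjoint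
  action of x_i together with the left skew derivation DL_i behaves like the
  raising and lowering operators of a quantum sl_2.  On the kernel of the right
  derivation DR_i the operator ad x_i is locally nilpotent modulo J
  (kernel_decomposition, J_DR_nilp): this is where the Serre relation
  ad(x_i)^3 (x_j) = 0 enters.  So u is killed by the lowering operator, has the
  positive weight 2 (d_i - d_j), and is killed by a power of the raising
  operator.  As q_ii is not a root of unity, u vanishes modulo J
  (J_lowest_weight).

- If d_0 = d_1 = m, use the antipode S.  A primitive element satisfies S u = - u,
  hence S (S u) = u.  But on tensors of degree d the square of S is the scalar
  chi(d, d) / (q_00^d_0 q_11^d_1), with indices from 0, which is q^((d_0 - d_1)^2 - d_0 - d_1)
  (antip_sqr, antip_sqr_scalarD).  Here it is q^(- 2 m), different from 1 for
  m <> 0, so u = 0 modulo J (antip_opp_mod_J, J_proj).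

The square of the antipode does the work that the quantum Casimir element does
in the classical proof for Kac-Moody algebras, and the first argument replaces
the reflections of the Weyl group. *)

Local Notation "u ** w" := (mmul u w) (at level 40, left associativity).

(** * Algebra maps between quotients, linear functions and ideals *)

Section QuotientMap.
Variables (F : fieldType) (A : algType F) (I I' : proper_ideal2 A).

Definition quot_map of (forall a, I a -> I' a) := fun x : alg_quot I => alg_pr I' (repr x).

Variable sub : forall a, I a -> I' a.
Local Notation f := (quot_map sub).

Lemma quot_map_pr a : f (alg_pr I a) = alg_pr I' a.
Proof. by apply/eqP/alg_prP/sub/alg_prI. Qed.

Lemma alg_pr_surj (x : alg_quot I) : exists a, x = alg_pr I a.
Proof. by exists (repr x); rewrite alg_pr_repr. Qed.

Lemma quot_map_linear : linear f.
Proof.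
move=> k x y; have [[a ->] [b ->]] := (alg_pr_surj x, alg_pr_surj y).
by rewrite -linearP !quot_map_pr linearP.
Qed.
HB.instance Definition _ := GRing.isLinear.Build F (alg_quot I) (alg_quot I') *:%R
  f quot_map_linear.

Lemma quot_map_monoid : monoid_morphism f.
Proof.
split; first by rewrite -(rmorph1 (alg_pr I)) quot_map_pr rmorph1.
move=> x y; have [[a ->] [b ->]] := (alg_pr_surj x, alg_pr_surj y).
by rewrite -rmorphM !quot_map_pr rmorphM.
Qed.
HB.instance Definition _ := GRing.isMonoidMorphism.Build (alg_quot I) (alg_quot I')
  f quot_map_monoid.
End QuotientMap.

Lemma quot_map_bij (F : fieldType) (A : algType F) (I I' : proper_ideal2 A)
  (sub : forall a, I a -> I' a) : (forall a, I' a -> I a) -> bijective (quot_map sub).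
Proof.
move=> sub'; exists (quot_map sub') => x; have [a ->] := alg_pr_surj x;
by rewrite !quot_map_pr.
Qed.

(** Linearity is often needed for functions with no bundled structure, such as the
partial applications of a bilinear map. *)
Section Linearity.
Variables (F : fieldType) (U V : lmodType F) (f : U -> V).
Hypothesis fL : linear f.

Lemma linear_add : {morph f : a b / a + b}.
Proof. by move=> a b; rewrite -[a]scale1r fL !scale1r. Qed.

Lemma linear_zero : f 0 = 0.
Proof. by have := fL (-1) 0 0; rewrite scaler0 addr0 scaleN1r addNr. Qed.

Lemma linear_scale k : {morph f : a / k *: a}.
Proof. by move=> a; rewrite -[k *: a]addr0 fL linear_zero addr0. Qed.
Lemma linear_opp : {morph f : a / - a}.
Proof. by move=> a; rewrite -[- a]scaleN1r linear_scale scaleN1r. Qed.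
End Linearity.

Definition span_closed (F : fieldType) (V : lmodType F) (P : V -> Prop) :=
  P 0 /\ forall (k : F) a b, P a -> P b -> P (k *: a + b).

Section IdealTheory.
Variables (F : fieldType) (A : algType F) (I : A -> Prop).
Hypothesis I_ideal : is_ideal I.

Lemma ideal0 : I 0. Proof. by case: I_ideal. Qed.
Lemma idealD a b : I a -> I b -> I (a + b).
Proof. by case: I_ideal => _ H _ _; exact: H. Qed.
Lemma idealMl a b : I b -> I (a * b).
Proof. by case: I_ideal => _ _ H _; exact: H. Qed.
Lemma idealMr a b : I a -> I (a * b).
Proof. by case: I_ideal => _ _ _ H; exact: H. Qed.
Lemma idealZ k a : I a -> I (k *: a).
Proof. by rewrite -mulr_algl; exact: idealMl. Qed.
Lemma idealN a : I a -> I (- a).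
Proof. by rewrite -scaleN1r; exact: idealZ. Qed.
Lemma idealB a b : I a -> I b -> I (a - b).
Proof. by move=> Ia Ib; apply: idealD => //; exact: idealN. Qed.
Lemma ideal_addr a b : I b -> I (a + b) -> I a.
Proof. by move=> Ib Iab; rewrite -[a](addrK b); exact: idealB. Qed.
Lemma ideal_lin k a b : I a -> I b -> I (k *: a + b).
Proof. by move=> Ia Ib; apply: idealD => //; exact: idealZ. Qed.
Lemma ideal_sum (K : Type) (r : seq K) (P : pred K) (f : K -> A) :
  (forall i, P i -> I (f i)) -> I (\sum_(i <- r | P i) f i).
Proof. by move=> If; elim/big_ind: _ => //; [exact: ideal0|exact: idealD]. Qed.
Lemma ideal_unscale (k : F) a : k != 0 -> I (k *: a) -> I a.
Proof. by move=> k0 /(idealZ k^-1); rewrite scalerA mulVf // scale1r. Qed.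
End IdealTheory.

(** * The tensor algebra through its basis of words *)

(** T(V) and its tensor square, seen only through the bases of words and of pairs
of words.  Nothing else about them is used until the last part: an identity
between linear maps is checked on words, and a linear map is given by its values
on words. *)
Record tensor_model (F : fieldType) (n : nat) := TensorModel {
  TA : algType F;
  TT : lmodType F;
  wd : {fmonom 'I_n} -> TA;
  ot : TA -> TA -> TT;
  wd1 : wd mone = 1;
  wdM : forall u w, wd (u ** w) = wd u * wd w;
  wd_ind : forall P : TA -> Prop, span_closed P -> (forall w, P (wd w)) ->
    forall a, P a;
  lext : forall M : lmodType F, ({fmonom 'I_n} -> M) -> TA -> M;
  lext_linear : forall M h, linear (@lext M h);
  lext_wd : forall M h w, @lext M h (wd w) = h w;
  ot_linearl : forall b, linear (ot^~ b);
  ot_linearr : forall a, linear (ot a);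
  ot_ind : forall P : TT -> Prop, span_closed P ->
    (forall u w, P (ot (wd u) (wd w))) -> forall z, P z;
  lext2 : forall M : lmodType F, ({fmonom 'I_n} -> {fmonom 'I_n} -> M) -> TT -> M;
  lext2_linear : forall M h, linear (@lext2 M h);
  lext2_ot : forall M h u w, @lext2 M h (ot (wd u) (wd w)) = h u w
}.
Arguments wd {F n t}.
Arguments ot {F n t}.

Lemma word_ind (n : nat) (P : {fmonom 'I_n} -> Prop) :
  P mone -> (forall i w, P w -> P (fmu i ** w)) -> forall w, P w.
Proof.
move=> P1 PM [s]; elim: s => [|i s IH].
  by have -> : FMonom [::] = mone :> {fmonom 'I_n} by apply/val_inj; rewrite /= fm1.
have -> : FMonom (i :: s) = fmu i ** FMonom s :> {fmonom 'I_n}.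
  by apply/val_inj; rewrite /= fmM fmU.
exact: PM.
Qed.

Section Degrees.
Variable n : nat.
Implicit Types u w : {fmonom 'I_n}.

Definition e_ (i : 'I_n) : 'rV[int]_n := delta_mx 0 i.

Lemma wdegM u w : wdeg (u ** w) = wdeg u + wdeg w.
Proof. by apply/rowP => i; rewrite !mxE fmM count_cat PoszD. Qed.

Lemma wdeg1 : wdeg mone = 0 :> 'rV[int]_n.
Proof. by apply/rowP => i; rewrite !mxE fm1. Qed.

Lemma wdeg_gen i : wdeg (fmu i) = e_ i.
Proof. by apply/rowP => j; rewrite !mxE fmU /= addn0 eq_sym; case: (j == i). Qed.

Definition ht (d : 'rV[int]_n) : int := \sum_i d 0 i.

Lemma htD d d' : ht (d + d') = ht d + ht d'.
Proof. by rewrite /ht -big_split; apply: eq_bigr => i _; rewrite mxE. Qed.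

Lemma htN d : ht (- d) = - ht d.
Proof. by rewrite /ht -sumrN; apply: eq_bigr => i _; rewrite mxE. Qed.

Lemma ht_gen i : ht (e_ i) = 1.
Proof.
rewrite /ht (bigD1 i) //= mxE !eqxx big1 ?addr0 // => j ji.
by rewrite mxE (negPf ji).
Qed.

Lemma ht_wdeg w : ht (wdeg w) = (fdeg w)%:Z.
Proof.
elim/word_ind: w => [|i w IH].
  by rewrite wdeg1 fdeg1 /ht big1 // => i _; rewrite mxE.
by rewrite wdegM htD wdeg_gen ht_gen IH fdegM fdegU PoszD.
Qed.

Lemma gen_mul_eq_gen i j w : (fmu i ** w == fmu j) = (i == j) && (w == mone).
Proof.
apply/eqP/andP => [/(congr1 (@fmonom_val _))|[/eqP-> /eqP->]]; last by rewrite mulm1.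
rewrite fmM !fmU /= => -[-> w0]; split=> //.
by rewrite -fdeg_eq0 fdegE w0.
Qed.

Lemma gen_mul_neq1 i w : (fmu i ** w == mone) = false.
Proof. by rewrite fmM_eq1 fm1_eq1. Qed.
End Degrees.

Section Bicharacter.
Variables (F : fieldType) (n : nat) (q : 'M[F]_n).
Hypothesis q_neq0 : forall i j, q i j != 0.
Implicit Types al be ga : 'rV[int]_n.

Lemma bicharDl al be ga : bichar q (al + be) ga = bichar q al ga * bichar q be ga.
Proof.
rewrite /bichar -big_split; apply: eq_bigr => i _ /=.
by rewrite -big_split; apply: eq_bigr => j _ /=; rewrite !mxE mulrDl expfzDr.
Qed.

Lemma bicharDr al be ga : bichar q al (be + ga) = bichar q al be * bichar q al ga.
Proof.
rewrite /bichar -big_split; apply: eq_bigr => i _ /=.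
by rewrite -big_split; apply: eq_bigr => j _ /=; rewrite !mxE mulrDr expfzDr.
Qed.

Lemma bichar0l al : bichar q 0 al = 1.
Proof. by rewrite /bichar big1 // => i _; rewrite big1 // => j _; rewrite mxE mul0r. Qed.

Lemma bichar0r al : bichar q al 0 = 1.
Proof. by rewrite /bichar big1 // => i _; rewrite big1 // => j _; rewrite mxE mulr0. Qed.

Lemma bichar_genl i be : bichar q (e_ i) be = \prod_j q i j ^ be 0 j.
Proof.
rewrite /bichar (bigD1 i) //= [X in _ * X]big1 => [|k ki].
  by rewrite mulr1; apply: eq_bigr => j _; rewrite mxE !eqxx mul1r.
by rewrite big1 // => l _; rewrite mxE (negPf ki) mul0r.
Qed.

Lemma bichar_gen i j : bichar q (e_ i) (e_ j) = q i j.
Proof.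
rewrite bichar_genl (bigD1 j) //= big1 ?mulr1 => [|k kj]; first by rewrite mxE !eqxx expr1z.
by rewrite mxE (negPf kj) andbF.
Qed.
End Bicharacter.

Section Model.
Variables (F : fieldType) (n : nat) (D : tensor_model F n).
Local Notation W := {fmonom 'I_n}.
Local Notation T := (TA D).
Local Notation T2 := (TT D).
Implicit Types (a b c : T) (z t : T2) (u v w : W) (i j : 'I_n).
Implicit Types (g : 'rV[int]_n -> F).

HB.instance Definition _ (M : lmodType F) h :=
  GRing.isLinear.Build F T M *:%R (@lext _ _ D M h) (@lext_linear _ _ D M h).
HB.instance Definition _ (M : lmodType F) h :=
  GRing.isLinear.Build F T2 M *:%R (@lext2 _ _ D M h) (@lext2_linear _ _ D M h).

Definition gen i : T := wd (fmu i).
Local Notation x := gen.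

Lemma wd_linear_ext (M : lmodType F) (f g : T -> M) :
  linear f -> linear g -> (forall w, f (wd w) = g (wd w)) -> f =1 g.
Proof.
move=> fL gL fg a; elim/wd_ind: a => [|//]; split; first by rewrite !linear_zero.
by move=> k a b Ea Eb; rewrite fL gL Ea Eb.
Qed.

Lemma ot_linear_ext (M : lmodType F) (f g : T2 -> M) : linear f -> linear g ->
  (forall u w, f (ot (wd u) (wd w)) = g (ot (wd u) (wd w))) -> f =1 g.
Proof.
move=> fL gL fg a; elim/ot_ind: a => [|//]; split; first by rewrite !linear_zero.
by move=> k a b Ea Eb; rewrite fL gL Ea Eb.
Qed.

Lemma gen_ind (P : T -> Prop) : (forall (k : F) a b, P a -> P b -> P (k *: a + b)) ->
  P 1 -> (forall i a, P a -> P (x i * a)) -> forall a, P a.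
Proof.
move=> PD P1 PM; apply: wd_ind => [|w].
  by split=> //; rewrite -[0](addNr 1) -scaleN1r; exact: PD.
by elim/word_ind: w => [|i w Pw]; rewrite ?wd1 // wdM; exact: PM.
Qed.

Lemma otDl a b c : ot (a + b) c = ot a c + ot b c.
Proof. exact: (linear_add (ot_linearl c)). Qed.
Lemma otZl (k : F) a c : ot (k *: a) c = k *: ot a c.
Proof. exact: (linear_scale (ot_linearl c)). Qed.
Lemma otDr a b c : ot a (b + c) = ot a b + ot a c.
Proof. exact: (linear_add (ot_linearr a)). Qed.
Lemma otZr (k : F) a c : ot a (k *: c) = k *: ot a c.
Proof. exact: (linear_scale (ot_linearr a)). Qed.

Lemma ot_bilinear_ext (M : lmodType F) (f g : T -> T -> M) :
  (forall b, linear (f^~ b)) -> (forall b, linear (g^~ b)) ->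
  (forall a, linear (f a)) -> (forall a, linear (g a)) ->
  (forall u w, f (wd u) (wd w) = g (wd u) (wd w)) -> forall a b, f a b = g a b.
Proof.
move=> fl gl fr gr fg a b; move: a; apply: wd_linear_ext => // u.
by move: b; apply: wd_linear_ext.
Qed.

(** The operator acting on the component of degree d by the scalar g d.  Such
operators stand for all homogeneity assumptions: projections onto a degree, the
characters by which the braiding acts and the scalars of the squared antipode are
twists, and identities with twists hold for inhomogeneous elements as well. *)
Definition twist g : T -> T := lext (fun w => g (wdeg w) *: wd w).
HB.instance Definition _ g := GRing.Linear.on (twist g).

Lemma twist_wd g w : twist g (wd w) = g (wdeg w) *: wd w.
Proof. exact: lext_wd. Qed.

Lemma eq_twist g h : g =1 h -> twist g =1 twist h.
Proof.
move=> gh; apply: wd_linear_ext => [||w]; [exact: linearP|exact: linearP|].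
by rewrite !twist_wd gh.
Qed.

Lemma twist1 a : twist (fun=> 1) a = a.
Proof.
move: a; apply: wd_linear_ext => [k a b|k a b|w]; rewrite ?linearP //.
by rewrite twist_wd scale1r.
Qed.

Lemma twist_comp g h a : twist g (twist h a) = twist (fun d => g d * h d) a.
Proof.
move: a; apply: wd_linear_ext => [k a b|k a b|w]; rewrite ?linearP //.
by rewrite !twist_wd linearZ /= twist_wd scalerA mulrC.
Qed.

Lemma scale_twist k g a : k *: twist g a = twist (fun d => k * g d) a.
Proof.
move: a; apply: wd_linear_ext => [l a b|l a b|w]; rewrite ?linearP //=.
by rewrite !twist_wd scalerA.
Qed.

Lemma twist_wdl g u a : twist g (wd u * a) = wd u * twist (fun d => g (wdeg u + d)) a.
Proof.
move: a; apply: wd_linear_ext => [k a b|k a b|w]; rewrite ?linearP ?mulrDr -?scalerAr ?linearP //.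
by rewrite -wdM !twist_wd wdegM -scalerAr wdM.
Qed.

Lemma twist_wdr g u a : twist g (a * wd u) = twist (fun d => g (d + wdeg u)) a * wd u.
Proof.
move: a; apply: wd_linear_ext => [k a b|k a b|w]; rewrite ?linearP ?mulrDl -?scalerAl ?linearP //.
by rewrite -wdM !twist_wd wdegM -scalerAl wdM.
Qed.

Lemma twistM g a b : {morph g : d d' / d + d' >-> d * d'} ->
  twist g (a * b) = twist g a * twist g b.
Proof.
move=> gM; move: a b; apply: ot_bilinear_ext => [b k a a'|b k a a'|a k b b'|a k b b'|u w].
- by rewrite mulrDl -scalerAl linearP.
- by rewrite linearP mulrDl -scalerAl.
- by rewrite mulrDr -scalerAr linearP.
- by rewrite linearP mulrDr -scalerAr.
by rewrite -wdM !twist_wd wdegM gM -scalerAl -scalerAr scalerA -wdM.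
Qed.

Definition proj d : T -> T := twist (fun d' => (d' == d)%:R).
HB.instance Definition _ d := GRing.Linear.on (proj d).

Lemma proj_wd d w : proj d (wd w) = (wdeg w == d)%:R *: wd w.
Proof. exact: twist_wd. Qed.

Lemma proj_ht_lt0 d a : ht d < 0 -> proj d a = 0.
Proof.
move=> d0; move: a; apply: wd_linear_ext => [|k a b|w]; first exact: linearP.
  by rewrite scaler0 addr0.
rewrite proj_wd; case: eqP => [dw|_]; last by rewrite scale0r.
by move: d0; rewrite -dw ht_wdeg.
Qed.

Lemma twist_proj g d a : twist g (proj d a) = g d *: proj d a.
Proof.
rewrite /proj twist_comp scale_twist; apply: eq_twist => d'.
by case: eqP => [->|_]; rewrite ?mulr1 ?mulr0.
Qed.

(** The sum is taken over any list containing the degrees of a, so that the lists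
for two summands can be merged. *)
Lemma sum_proj a : exists2 r : seq 'rV[int]_n, uniq r &
  forall r', uniq r' -> {subset r <= r'} -> a = \sum_(d <- r') proj d a.
Proof.
elim/wd_ind: a => [|w]; [split|].
- by exists [::] => // r' _ _; rewrite big1 // => d _; rewrite linear0.
- move=> k a b [r ru Er] [s su Es]; exists (undup (r ++ s)); first exact: undup_uniq.
  move=> r' r'u sub; rewrite {1}(Er r') // => [|d dr]; last first.
    by apply: sub; rewrite mem_undup mem_cat dr.
  rewrite {1}(Es r') // => [|d ds]; last first.
    by apply: sub; rewrite mem_undup mem_cat ds orbT.
  by rewrite scaler_sumr -big_split; apply: eq_bigr => d _; rewrite linearP.
exists [:: wdeg w] => // r' r'u sub.
rewrite (bigD1_seq (wdeg w)) //=; last by apply: sub; rewrite inE.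
rewrite proj_wd eqxx scale1r big1 ?addr0 // => d dw.
by rewrite proj_wd eq_sym (negPf dw) scale0r.
Qed.

Definition coef v (a : T) : F := @lext _ _ D F^o (fun w => (w == v)%:R) a.
Lemma coef_linear v : linear_for *%R (coef v).
Proof. exact: (@lext_linear _ _ D F^o). Qed.
HB.instance Definition _ v := GRing.isLinear.Build F T F *%R (coef v) (coef_linear v).
Lemma coef_wd v w : coef v (wd w) = (w == v)%:R.
Proof. exact: (@lext_wd _ _ D F^o). Qed.

Lemma coef1_gen_mul i a : coef mone (x i * a) = 0.
Proof.
move: a; apply: (@wd_linear_ext F^o) => [k a b|k a b|u].
- by rewrite mulrDr -scalerAr linearP.
- by rewrite scaler0 addr0.
- by rewrite -wdM coef_wd gen_mul_neq1.
Qed.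

Lemma coef1_1 : coef mone 1 = 1.
Proof. by rewrite -(wd1 D) coef_wd eqxx. Qed.

Lemma coef_gen_1 i : coef (fmu i) 1 = 0.
Proof. by rewrite -(wd1 D) coef_wd eq_sym fm1_eq1. Qed.

Lemma coef1M a b : coef mone (a * b) = coef mone a * coef mone b.
Proof.
elim/gen_ind: a => [k a a' Ea Ea'||i a _].
- by rewrite mulrDl -scalerAl !linearP /= Ea Ea' mulrDl mulrA.
- by rewrite mul1r coef1_1 mul1r.
- by rewrite -mulrA !coef1_gen_mul mul0r.
Qed.

Lemma proj0 a : proj 0 a = coef mone a *: 1.
Proof.
move: a; apply: wd_linear_ext => [k a b|k a b|w]; rewrite ?linearP //=.
  by rewrite scalerDl scalerA.
rewrite proj_wd coef_wd -(wd1 D); case: (eqVneq w mone) => [->|w1].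
  by rewrite wdeg1 eqxx.
case: eqP => [w0|_]; last by rewrite !scale0r.
have := ht_wdeg w; rewrite w0 -(@wdeg1 n) ht_wdeg fdeg1 => -[/esym/eqP].
by rewrite fdeg_eq0 (negPf w1).
Qed.

(** The maps id (x) v^* and v^* (x) id, where v^* is the coordinate function of the
word v. *)
Definition rslice v : T2 -> T := lext2 (fun u w => (w == v)%:R *: wd u).
HB.instance Definition _ v := GRing.Linear.on (rslice v).
Definition lslice v : T2 -> T := lext2 (fun u w => (u == v)%:R *: wd w).
HB.instance Definition _ v := GRing.Linear.on (lslice v).

Lemma rslice_ot v a b : rslice v (ot a b) = coef v b *: a.
Proof.
move: a b; apply: ot_bilinear_ext => [b k a a'|b k a a'|a k b b'|a k b b'|u w].
- by rewrite otDl otZl linearP.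
- by rewrite scalerDr !scalerA mulrC.
- by rewrite otDr otZr linearP.
- by rewrite linearP scalerDl -scalerA.
by rewrite coef_wd /rslice lext2_ot.
Qed.

Lemma lslice_ot v a b : lslice v (ot a b) = coef v a *: b.
Proof.
move: a b; apply: ot_bilinear_ext => [b k a a'|b k a a'|a k b b'|a k b b'|u w].
- by rewrite otDl otZl linearP.
- by rewrite linearP scalerDl -scalerA.
- by rewrite otDr otZr linearP.
- by rewrite scalerDr !scalerA mulrC.
by rewrite coef_wd /lslice lext2_ot.
Qed.

End Model.

(** * The braided bialgebra structure and its skew derivations *)

Section Braided.
Variables (F : fieldType) (n : nat) (D : tensor_model F n) (q : 'M[F]_n).
Hypothesis q_neq0 : forall i j, q i j != 0.
Local Notation W := {fmonom 'I_n}.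
Local Notation T := (TA D).
Local Notation T2 := (TT D).
Local Notation x := (gen D).
Local Notation wd := (@wd F n D).
Implicit Types (a b c : T) (z t : T2) (u v w : W) (i j : 'I_n).
Implicit Types (g : 'rV[int]_n -> F).

Definition chi u w := bichar q (wdeg u) (wdeg w).

Lemma chiMl u v w : chi (u ** v) w = chi u w * chi v w.
Proof. by rewrite /chi wdegM bicharDl. Qed.

Lemma chiMr u v w : chi u (v ** w) = chi u v * chi u w.
Proof. by rewrite /chi wdegM bicharDr. Qed.

Lemma chi1l w : chi mone w = 1.
Proof. by rewrite /chi wdeg1 bichar0l. Qed.

Lemma chi1r w : chi w mone = 1.
Proof. by rewrite /chi wdeg1 bichar0r. Qed.

Lemma chi_gen i j : chi (fmu i) (fmu j) = q i j.
Proof. by rewrite /chi !wdeg_gen bichar_gen. Qed.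

Definition bmul z t : T2 := lext2 (fun u v => lext2 (fun w w' =>
  chi v w *: ot (wd (u ** w)) (wd (v ** w'))) t) z.

Lemma bmul_wd u v w w' : bmul (ot (wd u) (wd v)) (ot (wd w) (wd w')) =
  chi v w *: ot (wd (u ** w)) (wd (v ** w')).
Proof. by rewrite /bmul !lext2_ot. Qed.

Lemma bmul_linearl t : linear (bmul^~ t).
Proof. exact: lext2_linear. Qed.

Lemma bmul_linearr z : linear (bmul z).
Proof.
elim/ot_ind: z => [|u w]; last by move=> k z t; rewrite /bmul !lext2_ot linearP.
split=> [k z t|k a b Ea Eb l z t]; first by rewrite !(linear_zero (bmul_linearl _)) scaler0 addr0.
by rewrite !(bmul_linearl _ k a b) Ea Eb !scalerDr addrACA !scalerA (mulrC l).
Qed.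

Lemma bmulDl z1 z2 t : bmul (z1 + z2) t = bmul z1 t + bmul z2 t.
Proof. exact: (linear_add (bmul_linearl t)). Qed.
Lemma bmulZl k z t : bmul (k *: z) t = k *: bmul z t.
Proof. exact: (linear_scale (bmul_linearl t)). Qed.
Lemma bmulDr z t1 t2 : bmul z (t1 + t2) = bmul z t1 + bmul z t2.
Proof. exact: (linear_add (bmul_linearr z)). Qed.
Lemma bmulZr k z t : bmul z (k *: t) = k *: bmul z t.
Proof. exact: (linear_scale (bmul_linearr z)). Qed.

Lemma bmul_bilinear_ext (M : lmodType F) (f g : T2 -> T2 -> M) :
  (forall t, linear (f^~ t)) -> (forall t, linear (g^~ t)) ->
  (forall z, linear (f z)) -> (forall z, linear (g z)) ->
  (forall u v w w', f (ot (wd u) (wd v)) (ot (wd w) (wd w')) =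
                    g (ot (wd u) (wd v)) (ot (wd w) (wd w'))) ->
  forall z t, f z t = g z t.
Proof.
move=> fl gl fr gr fg z t; move: z; apply: ot_linear_ext => // u v.
by move: t; apply: ot_linear_ext.
Qed.

Lemma bmulA z1 z2 z3 : bmul z1 (bmul z2 z3) = bmul (bmul z1 z2) z3.
Proof.
move: z1; apply: ot_linear_ext => [k z t|k z t|u1 v1]; rewrite ?bmulDl ?bmulZl //.
move: z2 z3; apply: bmul_bilinear_ext => [z k t t'|z k t t'|z k t t'|z k t t'|u2 v2 u3 v3].
- by rewrite bmulDl bmulZl bmulDr bmulZr.
- by rewrite bmulDr bmulZr bmulDl bmulZl.
- by rewrite !bmulDr !bmulZr.
- by rewrite bmulDr bmulZr.
rewrite !(bmul_wd, bmulZl, bmulZr) !scalerA !mulmA chiMl chiMr.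
by rewrite (mulrC (chi v2 u3)) !mulrA.
Qed.

Definition prim i : T2 := ot (x i) 1 + ot 1 (x i).

Definition comul : T -> T2 := lext (fun w : W => foldr (fun i => bmul (prim i)) (ot 1 1) w).
HB.instance Definition _ := GRing.Linear.on comul.

Lemma comul1 : comul 1 = ot 1 1.
Proof. by rewrite -{1}(wd1 D) /comul lext_wd fm1. Qed.

Lemma comul_gen_mul i a : comul (x i * a) = bmul (prim i) (comul a).
Proof.
move: a; apply: wd_linear_ext => [k a b|k a b|w].
- by rewrite mulrDr -scalerAr linearP.
- by rewrite linearP /= bmulDr bmulZr.
by rewrite -wdM /comul !lext_wd fmM fmU.
Qed.

Lemma bmul11 z : bmul (ot 1 1) z = z.
Proof.
move: z; apply: ot_linear_ext => // [k z t|u w]; first by rewrite bmulDr bmulZr.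
by rewrite -!(wd1 D) bmul_wd chi1l scale1r !mul1m.
Qed.

Lemma bmulz11 z : bmul z (ot 1 1) = z.
Proof.
move: z; apply: ot_linear_ext => // [k z t|u w]; first by rewrite bmulDl bmulZl.
by rewrite -!(wd1 D) bmul_wd chi1r scale1r !mulm1.
Qed.

Lemma comul_gen i : comul (x i) = prim i.
Proof. by rewrite -[x i]mulr1 comul_gen_mul comul1 bmulz11. Qed.

Lemma comulM a b : comul (a * b) = bmul (comul a) (comul b).
Proof.
elim/gen_ind: a => [k a a' Ea Ea'||i a Ea].
- by rewrite mulrDl -scalerAl !linearP /= bmulDl bmulZl Ea Ea'.
- by rewrite mul1r comul1 bmul11.
- by rewrite -mulrA !comul_gen_mul Ea bmulA.
Qed.

Lemma bmul_otl a v c b : bmul (ot a (wd v)) (ot c b) =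
  ot (a * twist (bichar q (wdeg v)) c) (wd v * b).
Proof.
move: a; apply: wd_linear_ext => [k a a'|k a a'|u].
- by rewrite otDl otZl bmulDl bmulZl.
- by rewrite mulrDl -scalerAl otDl otZl.
move: c b; apply: ot_bilinear_ext => [b k a a'|b k a a'|a k b b'|a k b b'|w w'].
- by rewrite otDl otZl bmulDr bmulZr.
- by rewrite linearP mulrDr -scalerAr otDl otZl.
- by rewrite otDr otZr bmulDr bmulZr.
- by rewrite mulrDr -scalerAr otDr otZr.
by rewrite bmul_wd twist_wd -scalerAr -!wdM otZl.
Qed.

Lemma bmul_otr a c w b : bmul (ot a c) (ot (wd w) b) =
  ot (a * wd w) (twist (fun d => bichar q d (wdeg w)) c * b).
Proof.
move: a; apply: wd_linear_ext => [k a a'|k a a'|u].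
- by rewrite otDl otZl bmulDl bmulZl.
- by rewrite mulrDl -scalerAl otDl otZl.
move: c b; apply: ot_bilinear_ext => [b k a a'|b k a a'|a k b b'|a k b b'|v w'].
- by rewrite otDr otZr bmulDl bmulZl.
- by rewrite linearP mulrDl -scalerAl otDr otZr.
- by rewrite otDr otZr bmulDr bmulZr.
- by rewrite mulrDr -scalerAr otDr otZr.
by rewrite bmul_wd twist_wd -scalerAl -!wdM otZr.
Qed.

(** The braiding moves x_i past a as x_i (x) a |-> tau_i(a) (x) x_i, and tau'_i is
its counterpart for a (x) x_i. *)
Definition tau i : T -> T := twist (bichar q (e_ i)).
HB.instance Definition _ i := GRing.Linear.on (tau i).
Definition tau' i : T -> T := twist (fun d => bichar q d (e_ i)).
HB.instance Definition _ i := GRing.Linear.on (tau' i).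

Lemma tauM i a b : tau i (a * b) = tau i a * tau i b.
Proof. by apply: twistM => d d'; rewrite bicharDr. Qed.
Lemma tau'M i a b : tau' i (a * b) = tau' i a * tau' i b.
Proof. by apply: twistM => d d'; rewrite bicharDl. Qed.
Lemma tau_wd i w : tau i (wd w) = chi (fmu i) w *: wd w.
Proof. by rewrite /tau twist_wd /chi wdeg_gen. Qed.
Lemma tau'_wd i w : tau' i (wd w) = chi w (fmu i) *: wd w.
Proof. by rewrite /tau' twist_wd /chi wdeg_gen. Qed.
Lemma tau1 i : tau i 1 = 1.
Proof. by rewrite -(wd1 D) tau_wd chi1r scale1r. Qed.
Lemma tau'1 i : tau' i 1 = 1.
Proof. by rewrite -(wd1 D) tau'_wd chi1l scale1r. Qed.
Lemma tau_gen i j : tau i (x j) = q i j *: x j.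
Proof. by rewrite tau_wd chi_gen. Qed.
Lemma tau'_gen i j : tau' i (x j) = q j i *: x j.
Proof. by rewrite tau'_wd chi_gen. Qed.

Lemma tau_exp i m : tau i (x i ^+ m) = q i i ^+ m *: x i ^+ m.
Proof.
elim: m => [|m IH]; first by rewrite tau1 scale1r.
by rewrite !exprS tauM IH tau_gen -scalerAl -scalerAr scalerA.
Qed.

Lemma prim_bmul i u w : bmul (prim i) (ot (wd u) (wd w)) =
  ot (wd (fmu i ** u)) (wd w) + chi (fmu i) u *: ot (wd u) (wd (fmu i ** w)).
Proof. by rewrite bmulDl -!(wd1 D) !bmul_wd chi1l scale1r !mul1m. Qed.

(** The skew derivations: the coefficient of x_i in the second (DR), respectively
in the first (DL) tensor factor of the coproduct. *)
Definition DR i a : T := rslice (fmu i) (comul a).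
HB.instance Definition _ i := GRing.Linear.copy (DR i) (@rslice F n D (fmu i) \o comul).
Definition DL i a : T := lslice (fmu i) (comul a).
HB.instance Definition _ i := GRing.Linear.copy (DL i) (@lslice F n D (fmu i) \o comul).

Lemma rcounit a : rslice mone (comul a) = a.
Proof.
elim/gen_ind: a => [k a b Ea Eb||i a Ea]; first by rewrite !linearP /= Ea Eb.
  by rewrite comul1 -(wd1 D) rslice_ot coef_wd eqxx scale1r.
rewrite comul_gen_mul -{2}Ea; move: (comul a); apply: ot_linear_ext => [k z t|k z t|u w].
- by rewrite bmulDr bmulZr linearP.
- by rewrite linearP mulrDr -scalerAr.
rewrite prim_bmul linearD linearZ /= !rslice_ot !coef_wd gen_mul_neq1.
by rewrite scale0r scaler0 addr0 wdM scalerAr.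
Qed.

Lemma lcounit a : lslice mone (comul a) = a.
Proof.
elim/gen_ind: a => [k a b Ea Eb||i a Ea]; first by rewrite !linearP /= Ea Eb.
  by rewrite comul1 -(wd1 D) lslice_ot coef_wd eqxx scale1r.
rewrite comul_gen_mul -{2}Ea; move: (comul a); apply: ot_linear_ext => [k z t|k z t|u w].
- by rewrite bmulDr bmulZr linearP.
- by rewrite linearP mulrDr -scalerAr.
rewrite prim_bmul linearD linearZ /= !lslice_ot !coef_wd gen_mul_neq1.
rewrite scale0r add0r wdM scalerAr; case: eqP => [->|_]; last by rewrite !scale0r mulr0 scaler0.
by rewrite chi1r !scale1r.
Qed.

Lemma DR_gen_mul i j a : DR i (x j * a) = x j * DR i a + (j == i)%:R *: tau i a.
Proof.
rewrite /DR comul_gen_mul -{3}(rcounit a); move: (comul a).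
apply: ot_linear_ext => [k z t|k z t|u w].
- by rewrite bmulDr bmulZr linearP.
- by rewrite !linearP /= mulrDr -scalerAr !scalerDr !scalerA addrACA mulrC.
rewrite prim_bmul linearD linearZ /= !rslice_ot.
rewrite [tau i (_ *: _)]linearZ /= tau_wd !coef_wd gen_mul_eq_gen.
rewrite wdM -scalerAr !scalerA; congr (_ + _).
by case: eqP => [->|_]; rewrite ?mul0r ?mulr0 ?scale0r //= mul1r mulrC.
Qed.

Lemma DL_gen_mul i j a : DL i (x j * a) = (j == i)%:R *: a + q j i *: (x j * DL i a).
Proof.
rewrite /DL comul_gen_mul -{2}(lcounit a); move: (comul a).
apply: ot_linear_ext => [k z t|k z t|u w].
- by rewrite bmulDr bmulZr linearP.
- by rewrite !linearP /= mulrDr -scalerAr !scalerDr !scalerA addrACA !(mulrC k).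
rewrite prim_bmul linearD linearZ /= !lslice_ot !coef_wd gen_mul_eq_gen.
rewrite wdM -scalerAr !scalerA; congr (_ + _); first by rewrite -mulnb natrM.
by case: eqP => [->|_]; rewrite ?mulr0 ?scale0r //= chi_gen.
Qed.

Lemma DR1 i : DR i 1 = 0.
Proof. by rewrite /DR comul1 -(wd1 D) rslice_ot coef_wd eq_sym fm1_eq1 scale0r. Qed.
Lemma DL1 i : DL i 1 = 0.
Proof. by rewrite /DL comul1 -(wd1 D) lslice_ot coef_wd eq_sym fm1_eq1 scale0r. Qed.
Lemma DR_gen i j : DR i (x j) = (j == i)%:R.
Proof. by rewrite -[x j]mulr1 DR_gen_mul DR1 mulr0 add0r tau1 scaler_nat. Qed.
Lemma DL_gen i j : DL i (x j) = (j == i)%:R.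
Proof. by rewrite -[x j]mulr1 DL_gen_mul DL1 mulr0 scaler0 addr0 scaler_nat. Qed.

Lemma DRM i a b : DR i (a * b) = a * DR i b + DR i a * tau i b.
Proof.
elim/gen_ind: a => [k a a' Ea Ea'||j a Ea].
- by rewrite !mulrDl -!scalerAl !linearP /= Ea Ea' mulrDl -scalerAl scalerDr addrACA.
- by rewrite !mul1r DR1 mul0r addr0.
- by rewrite -!mulrA !DR_gen_mul Ea mulrDr mulrDl tauM -scalerAl !mulrA addrA.
Qed.

Lemma DLM i a b : DL i (a * b) = DL i a * b + tau' i a * DL i b.
Proof.
elim/gen_ind: a => [k a a' Ea Ea'||j a Ea].
- by rewrite !mulrDl -!scalerAl !linearP /= Ea Ea' !mulrDl -!scalerAl scalerDr addrACA.
- by rewrite !mul1r DL1 mul0r add0r tau'1 mul1r.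
by rewrite -!mulrA !DL_gen_mul Ea mulrDr mulrDl tau'M tau'_gen -!scalerAl scalerDr !mulrA addrA.
Qed.

Lemma DR_twist i g a : DR i (twist g a) = twist (fun d => g (d + e_ i)) (DR i a).
Proof.
move: g; elim/gen_ind: a => [k a b Ea Eb g||j a Ea g]; first by rewrite !linearP /= Ea Eb.
  by move=> g; rewrite DR1 linear0 -(wd1 D) twist_wd linearZ /= wd1 DR1 scaler0.
rewrite /gen twist_wdl -/(gen D j) DR_gen_mul Ea DR_gen_mul linearD /= /gen twist_wdl linearZ /=.
congr (_ + _); first by congr (_ * _); apply: eq_twist => d; rewrite addrA.
case: eqP => [->|_]; last by rewrite !scale0r.
rewrite !scale1r /tau !twist_comp; apply: eq_twist => d.
by rewrite wdeg_gen mulrC addrC.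
Qed.

Lemma DL_twist i g a : DL i (twist g a) = twist (fun d => g (d + e_ i)) (DL i a).
Proof.
move: g; elim/gen_ind: a => [k a b Ea Eb g||j a Ea g]; first by rewrite !linearP /= Ea Eb.
  by move=> g; rewrite DL1 linear0 -(wd1 D) twist_wd linearZ /= wd1 DL1 scaler0.
rewrite /gen twist_wdl -/(gen D j) DL_gen_mul Ea DL_gen_mul linearD /= !linearZ /= /gen twist_wdl.
congr (_ + _); last by congr (_ *: (_ * _)); apply: eq_twist => d; rewrite addrA.
case: eqP => [->|_]; last by rewrite !scale0r.
by rewrite !scale1r; apply: eq_twist => d; rewrite wdeg_gen addrC.
Qed.

(** With this, the vanishing of the coefficients of the generators on an ideal
follows from its stability under the derivations and from its vanishing counit. *)
Lemma coef_DR i a : coef mone (DR i a) = coef (fmu i) a.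
Proof.
elim/gen_ind: a => [k a b Ea Eb||j a Ea]; first by rewrite !linearP /= Ea Eb.
  by rewrite DR1 linear0 -(wd1 D) coef_wd eq_sym fm1_eq1.
move: a {Ea}; apply: (@wd_linear_ext _ _ D F^o) => [k a b|k a b|w].
- by rewrite mulrDr -scalerAr !linearP.
- by rewrite mulrDr -scalerAr !linearP.
rewrite DR_gen_mul -wdM coef_wd gen_mul_eq_gen linearD linearZ /= tau_wd linearZ /= coef_wd.
have -> : coef mone (x j * DR i (wd w)) = 0.
  exact: coef1_gen_mul.
rewrite add0r; case: eqP => _; rewrite ?mul0r // mul1r.
by case: eqP => [->|_]; rewrite ?mulr0 // chi1r mulr1.
Qed.

(** The antipode S is the braided antiautomorphism with S x_i = - x_i, that is
S (x_i w) = - chi (x_i, w) S (w) x_i. *)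
Fixpoint antip_seq (s : seq 'I_n) : T :=
  if s is i :: s' then - chi (fmu i) (FMonom s') *: (antip_seq s' * x i) else 1.
Definition antip : T -> T := lext (fun w : W => antip_seq w).
HB.instance Definition _ := GRing.Linear.on antip.

Lemma antip1 : antip 1 = 1.
Proof. by rewrite -{1}(wd1 D) /antip lext_wd fm1. Qed.

Lemma antip_gen_mul i a : antip (x i * a) = - (antip (tau i a) * x i).
Proof.
move: a; apply: wd_linear_ext => [k a b|k a b|w].
- by rewrite mulrDr -scalerAr linearP.
- by rewrite !linearP /= mulrDl -scalerAl opprD scalerN.
rewrite -wdM tau_wd linearZ /= /antip !lext_wd fmM fmU /= fmK.
by rewrite -scalerAl scaleNr.
Qed.

Lemma antip_gen i : antip (x i) = - x i.
Proof. by rewrite -[x i]mulr1 antip_gen_mul tau1 antip1 mul1r mulr1. Qed.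

Lemma antip_wdl u a :
  antip (wd u * a) = antip (twist (bichar q (wdeg u)) a) * antip (wd u).
Proof.
move: a; elim/word_ind: u => [|i u Eu] a.
  rewrite (wd1 D) antip1 mul1r mulr1 wdeg1; congr antip; move: a.
  by apply: wd_linear_ext => [|k a b|w] //; rewrite ?linearP // twist_wd bichar0l scale1r.
rewrite wdM -mulrA !antip_gen_mul tauM tau_wd -scalerAl !linearZ /= -!scalerAl Eu.
rewrite mulrN -scalerAr mulrA; congr (- (_ *: (antip _ * _ * _))).
by rewrite /tau twist_comp; apply: eq_twist => d; rewrite wdegM wdeg_gen bicharDl // mulrC.
Qed.

Lemma antip_wdr u a :
  antip (a * wd u) = antip (wd u) * antip (twist (fun d => bichar q d (wdeg u)) a).
Proof.
move: a; apply: wd_linear_ext => [k a b|k a b|w].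
- by rewrite mulrDl -scalerAl linearP.
- by rewrite !linearP mulrDr -scalerAr.
by rewrite antip_wdl !twist_wd !linearZ /= -scalerAl -scalerAr.
Qed.

Lemma antip_twist g a : antip (twist g a) = twist g (antip a).
Proof.
move: g; elim/gen_ind: a => [k a b Ea Eb g|g|j a Ea g]; first by rewrite !linearP /= Ea Eb.
  by rewrite antip1 -(wd1 D) twist_wd linearZ /= wd1 antip1.
rewrite /gen twist_wdl -/(gen D j) !antip_gen_mul linearN /= /gen twist_wdr /tau.
rewrite twist_comp !Ea twist_comp; congr (- (_ * _)); apply: eq_twist => d.
by rewrite mulrC addrC.
Qed.

(** Applying S twice restores the order of the letters and picks up chi (x, y) once
for each ordered pair of distinct positions.  The total depends on the degree
only; the hypotheses are its recursion. *)
Lemma antip_sqr g a : g 0 = 1 ->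
  (forall i d, g (d + e_ i) = bichar q (e_ i) d * bichar q d (e_ i) * g d) ->
  antip (antip a) = twist g a.
Proof.
move=> g0 gM; move: a; apply: wd_linear_ext => [k a b|k a b|w]; rewrite ?linearP //.
rewrite twist_wd; elim/word_ind: w => [|i w Ew].
  by rewrite (wd1 D) !antip1 wdeg1 g0 scale1r.
rewrite wdM antip_gen_mul linearN /= /gen antip_wdr antip_gen -antip_twist.
rewrite tau_wd !linearZ /= twist_wd !linearZ /= Ew !scalerA mulNr opprK -scalerAr.
by rewrite /chi wdegM wdeg_gen [e_ i + _]addrC gM (mulrC (bichar q (e_ i) _)).
Qed.

(** The braided adjoint action ad x_i. *)
Definition adx i a : T := x i * a - tau i a * x i.

Lemma adx_linear i : linear (adx i).
Proof.
move=> k a b; rewrite /adx mulrDr linearP mulrDl -!scalerAr -!scalerAl scalerBr.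
by rewrite opprD addrACA.
Qed.
HB.instance Definition _ i := GRing.isLinear.Build F T T *:%R (adx i) (adx_linear i).

(** Multiplying by x_i inside the coproduct turns m (id (x) S) Delta into its image
under ad x_i, and ad x_i kills the scalars. *)
Lemma antipode_axiom a :
  lext2 (fun u w => wd u * antip (wd w)) (comul a) = coef mone a *: 1.
Proof.
elim/gen_ind: a => [k a b Ea Eb||i a Ea].
- by rewrite !linearP /= Ea Eb scalerDl scalerA.
- by rewrite comul1 -(wd1 D) lext2_ot (wd1 D) antip1 mul1r -(wd1 D) coef_wd eqxx scale1r.
have -> : coef mone (x i * a) = 0.
  exact: coef1_gen_mul.
rewrite scale0r comul_gen_mul.
have -> z : lext2 (fun u w => wd u * antip (wd w)) (bmul (prim i) z) =
          adx i (lext2 (fun u w => wd u * antip (wd w)) z).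
  move: z; apply: ot_linear_ext => [k z t|k z t|u w].
  - by rewrite bmulDr bmulZr linearP.
  - by rewrite !linearP.
  rewrite prim_bmul linearD linearZ /= !lext2_ot !wdM antip_gen_mul /adx mulrA tauM.
  by rewrite antip_twist -/(tau i _) tau_wd -!scalerAl mulrN scalerN mulrA.
by rewrite Ea linearZ /= /adx tau1 mulr1 mul1r subrr scaler0.
Qed.

Lemma adx1 i : adx i 1 = 0.
Proof. by rewrite /adx tau1 mulr1 mul1r subrr. Qed.

Lemma adxM i a b : adx i (a * b) = adx i a * b + tau i a * adx i b.
Proof.
by rewrite /adx mulrBl mulrBr tauM !mulrA addrA subrK.
Qed.

Lemma adx_twist i g a : adx i (twist g a) = twist (fun d => g (d - e_ i)) (adx i a).
Proof.
rewrite /adx linearB /= /gen twist_wdl twist_wdr wdeg_gen; congr (_ - _).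
  by congr (_ * _); apply: eq_twist => d; rewrite [e_ i + d]addrC addrK.
by congr (_ * _); rewrite /tau !twist_comp; apply: eq_twist => d; rewrite addrK mulrC.
Qed.

Lemma iter_adx_twist i g N a :
  exists h, iter N (adx i) (twist g a) = twist h (iter N (adx i) a).
Proof.
elim: N => [|N [h Eh]] /=; first by exists g.
by exists (fun d => h (d - e_ i)); rewrite Eh adx_twist.
Qed.

(** The action of the double braiding with x_i, in the role of the square of the
Cartan element of the quantum sl_2 attached to i. *)
Definition theta i : T -> T := twist (fun d => bichar q (e_ i) d * bichar q d (e_ i)).
HB.instance Definition _ i := GRing.Linear.on (theta i).

Lemma theta_tau i a : theta i a = tau' i (tau i a).
Proof. by rewrite /tau /tau' twist_comp; apply: eq_twist => d; rewrite mulrC. Qed.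

(** The commutation relation of the lowering operator DL_i with the raising
operator ad x_i. *)
Lemma DL_adx i a : DL i (adx i a) = a - theta i a + q i i *: adx i (DL i a).
Proof.
rewrite /adx linearB /= DL_gen_mul eqxx scale1r DLM DL_gen eqxx mulr1.
rewrite /tau DL_twist -/(tau i _).
have -> : twist (fun d => bichar q (e_ i) (d + e_ i)) (DL i a) = q i i *: tau i (DL i a).
  by rewrite /tau scale_twist; apply: eq_twist => d; rewrite bicharDr // bichar_gen mulrC.
rewrite -theta_tau scalerBr -scalerAl opprD [- _ - theta i a]addrC addrACA.
by [].
Qed.

Lemma DR_adx i a : DR i a = 0 -> DR i (adx i a) = 0.
Proof.
move=> a0; rewrite /adx linearB /= DR_gen_mul eqxx scale1r a0 mulr0 add0r DRM.
by rewrite DR_gen eqxx mulr1 /tau DR_twist a0 linear0 mul0r addr0 subrr.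
Qed.

Lemma theta_adx i a (k : F) :
  theta i a = k *: a -> theta i (adx i a) = (q i i ^+ 2 * k) *: adx i a.
Proof.
move=> ka; rewrite -scalerA -(linear_scale (adx_linear i)) -ka /theta adx_twist scale_twist.
apply: eq_twist => d; rewrite -{1 2}[d](subrK (e_ i)).
by move: (d - e_ i) => d0; rewrite bicharDl // bicharDr // bichar_gen; ring.
Qed.

Lemma mul_antip_ot a b :
  lext2 (fun u w => wd u * antip (wd w)) (ot a b) = a * antip b.
Proof.
move: a b; apply: ot_bilinear_ext => [b k a a'|b k a a'|a k b b'|a k b b'|u w].
- by rewrite otDl otZl linearP.
- by rewrite mulrDl -scalerAl.
- by rewrite otDr otZr linearP.
- by rewrite linearP mulrDr -scalerAr.
by rewrite lext2_ot.
Qed.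

(** As twist_wdr, with S w in place of w: both have the same degree. *)
Lemma twist_mul_antip g a w : twist g (a * antip (wd w)) =
  twist (fun d => g (d + wdeg w)) a * antip (wd w).
Proof.
move: g; elim/word_ind: w => [|i w Ew] g.
  by rewrite (wd1 D) antip1 !mulr1; apply: eq_twist => d; rewrite wdeg1 addr0.
rewrite wdM -/(gen D i) antip_gen_mul tau_wd linearZ /= -scalerAl.
rewrite !mulrN -!scalerAr !linearN !linearZ /= !mulrA /gen twist_wdr Ew.
congr (_ *: - (_ * _ * _)); apply: eq_twist => d.
by rewrite wdegM [wdeg _ + _]addrC addrA.
Qed.

(** Multiplication by words suffices in an induction over a generated ideal; as words
are homogeneous, the skew Leibniz rules and the braiding are simple for them. *)
Lemma generated_ideal_wd_ind (s : seq T) (P : T -> Prop) : span_closed P ->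
  (forall r, r \in s -> P r) ->
  (forall w a, generated_ideal s a -> P a -> P (wd w * a)) ->
  (forall w a, generated_ideal s a -> P a -> P (a * wd w)) ->
  forall a, generated_ideal s a -> P a.
Proof.
move=> [P0 PD] Ps Pl Pr a Ja; have Jid := generated_ideal_is_ideal s.
suff [] : generated_ideal s a /\ P a by [].
apply: (Ja (fun b => generated_ideal s b /\ P b)) => [|r rs]; last first.
  by split; [move=> I _ sI; exact: sI|exact: Ps].
split=> [|b c [Jb Pb] [Jc Pc]|b c [Jc Pc]|b c [Jb Pb]].
- by split=> //; exact: (ideal0 Jid).
- by split; [exact: (idealD Jid)|rewrite -[b]scale1r; exact: PD].
- split; first exact: (idealMl Jid).
  elim/wd_ind: b => [|w]; last exact: Pl.
  by split=> [|k b b' Pb Pb']; rewrite ?mul0r // mulrDl -scalerAl; exact: PD.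
- split; first exact: (idealMr Jid).
  elim/wd_ind: c => [|w]; last exact: Pr.
  by split=> [|k c c' Pc Pc']; rewrite ?mulr0 // mulrDr -scalerAr; exact: PD.
Qed.

(** The subspace I (x) T + T (x) I. *)
Definition cspan (I : T -> Prop) z := exists2 s : seq (T * T),
  (forall p, p \in s -> I p.1 \/ I p.2) & z = \sum_(p <- s) ot p.1 p.2.

Lemma cspan_ot (I : T -> Prop) a b : I a \/ I b -> cspan I (ot a b).
Proof.
by move=> Iab; exists [:: (a, b)]; rewrite ?big_seq1 // => p; rewrite inE => /eqP->.
Qed.

Lemma cspan_span_closed (I : T -> Prop) : is_ideal I -> span_closed (cspan I).
Proof.
move=> Iid; split=> [|k _ _ [r rI ->] [s sI ->]]; first by exists [::]; rewrite ?big_nil.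
exists ([seq (k *: p.1, p.2) | p <- r] ++ s); last first.
  rewrite big_cat big_map scaler_sumr /=; congr (_ + _).
  by apply: eq_bigr => p _; rewrite otZl.
move=> p; rewrite mem_cat => /orP[/mapP[p' /rI Ip ->]|/sI //] /=.
by case: Ip => Ip; [left; exact: idealZ|right].
Qed.

Lemma coef1_adx i a : coef mone (adx i a) = 0.
Proof.
by rewrite linearB /= coef1_gen_mul coef1M coef_wd fm1_eq1 mulr0 subrr.
Qed.

Lemma coef_gen_adx i j a : coef (fmu j) (adx i a) = 0.
Proof.
rewrite -coef_DR /adx linearB /= DR_gen_mul DRM DR_gen tau_gen linearB !linearD /=.
rewrite linearZ /= !coef1M linearZ /= !(coef_wd _ mone (fmu _)) fm1_eq1 mul0r !mulr0 add0r addr0.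
case: eqP => [->|_]; first by rewrite !mulr1n coef1_1 mul1r mulr1 subrr.
by rewrite !mulr0n linear0 mul0r mulr0 subrr.
Qed.

Lemma adx_homogeneous i a d : (forall g, twist g a = g d *: a) ->
  forall g, twist g (adx i a) = g (d + e_ i) *: adx i a.
Proof.
move=> da g; rewrite -(linear_scale (adx_linear i)).
rewrite -(da (fun d => g (d + e_ i))) adx_twist.
by apply: eq_twist => d'; rewrite subrK.
Qed.

(** * Primitivity of the Serre elements *)

Definition twist2 i : T2 -> T2 :=
  lext2 (fun u w => (chi (fmu i) u * chi (fmu i) w) *: ot (wd u) (wd w)).
HB.instance Definition _ i := GRing.Linear.on (twist2 i).

Lemma comul_tau i a : comul (tau i a) = twist2 i (comul a).
Proof.
elim/gen_ind: a => [k a b Ea Eb||j a Ea]; first by rewrite !linearP /= Ea Eb.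
  rewrite tau1 comul1 -(wd1 D) /twist2 lext2_ot chi1r mulr1 scale1r //.
rewrite tauM tau_gen -scalerAl linearZ /= !comul_gen_mul Ea.
move: (comul a); apply: ot_linear_ext => [k z t|k z t|u w].
- by rewrite linearP bmulDr bmulZr scalerDr !scalerA mulrC.
- by rewrite bmulDr bmulZr linearP.
rewrite prim_bmul linearD linearZ /= /twist2 !lext2_ot bmulZr prim_bmul.
by rewrite !chiMr chi_gen !scalerDr !scalerA; congr (_ *: _ + _ *: _); ring.
Qed.

Lemma comul_adx i a :
  comul (adx i a) = bmul (prim i) (comul a) - bmul (twist2 i (comul a)) (prim i).
Proof. by rewrite linearB /= comul_gen_mul comulM comul_tau comul_gen. Qed.

(** The adjoint action of x_i on the tensor square, for which the coproduct is
equivariant. *)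
Definition adx2 i z : T2 := bmul (prim i) z - bmul (twist2 i z) (prim i).

Lemma adx2_linear i : linear (adx2 i).
Proof.
move=> k z t; rewrite /adx2 [twist2 i _]linearP /= (bmul_linearr (prim i)) (bmul_linearl (prim i)).
rewrite scalerBr opprD.
by rewrite addrACA.
Qed.

(** The first two terms are the skew Leibniz rule.  The last one comes from moving
x_i past c twice, and it vanishes when the double braiding of x_i with c is
trivial. *)
Lemma adx2_ot i b c : adx2 i (ot b c) =
  ot (adx i b) c + ot (tau i b) (adx i c) + ot (tau i b * x i) (c - theta i c).
Proof.
move: b c; apply: ot_bilinear_ext => [c k b b'|c k b b'|b k c c'|b k c c'|u w].
- by rewrite otDl otZl adx2_linear.
- rewrite (adx_linear i) [tau i (_ + _)]linearP /= mulrDl -scalerAl.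
  move: (adx i b) (adx i b') (c - _) (adx i c) => B B' C C'.
  by rewrite !(otDl, otZl) !scalerDr (addrACA (k *: ot B c)) [LHS]addrACA.
- by rewrite otDr otZr adx2_linear.
- rewrite (adx_linear i) [theta i (_ + _)]linearP /= opprD addrACA -scalerN -scalerDr.
  move: (adx i b) (adx i c) (adx i c') (c - _) (c' - _) => B C C' S S'.
  by rewrite !(otDr, otZr) !scalerDr (addrACA (k *: ot B c)) [LHS]addrACA.
have otN (a b : T) : ot a (- b) = - ot a b by exact: (linear_opp (ot_linearr a)).
have otNl (a b : T) : ot (- a) b = - ot a b by exact: (linear_opp (ot_linearl b)).
rewrite /adx2 prim_bmul /twist2 lext2_ot bmulZl /adx /theta twist_wd !tau_wd.
rewrite bmulDr -!(wd1 D) !bmul_wd !mulm1 chi1r scale1r !wdM.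
rewrite -!scalerAl -wdeg_gen -!/(chi _ _) /gen !(otDl, otDr, otN, otNl, otZl, otZr).
rewrite !(scalerDr, scalerN, scalerA).
have -> : chi (fmu i) u * chi (fmu i) w * chi w (fmu i) =
  chi (fmu i) w * chi w (fmu i) * chi (fmu i) u by ring.
by rewrite opprD addrACA [RHS]addrAC; congr (_ + _); rewrite addrA subrK.
Qed.

Lemma adx_eigen i a (k : F) : tau i a = k *: a -> adx i a = x i * a - k *: (a * x i).
Proof. by move=> ka; rewrite /adx ka -scalerAl. Qed.

Lemma tau_adx i a (k : F) : tau i a = k *: a -> tau i (adx i a) = (q i i * k) *: adx i a.
Proof.
move=> ka; rewrite (adx_eigen ka) linearB linearZ /= !tauM tau_gen ka.
by rewrite scalerBr -!scalerAl -!scalerAr !scalerA; congr (_ - _ *: _); ring.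
Qed.

(** The right-handed adjoint action, in which the second Serre relation is
stated. *)
Definition radx i a : T := a * x i - x i * tau' i a.

Lemma radx_eigen i a (k : F) : tau' i a = k *: a -> radx i a = a * x i - k *: (x i * a).
Proof. by move=> ka; rewrite /radx ka -scalerAr. Qed.

Lemma tau'_radx i a (k : F) :
  tau' i a = k *: a -> tau' i (radx i a) = (q i i * k) *: radx i a.
Proof.
move=> ka; rewrite (radx_eigen ka) linearB linearZ /= !tau'M tau'_gen ka.
by rewrite scalerBr -!scalerAl -!scalerAr !scalerA; congr (_ *: _ - _ *: _); ring.
Qed.

Section SerreElement.
Variables i j : 'I_n.
Local Notation Q := (q i i).
Hypothesis qij : Q ^+ 2 * (q i j * q j i) = 1.
Local Notation ad := (adx i).

Lemma adx_gen_exp l : ad (x i ^+ l) = (1 - Q ^+ l) *: x i ^+ l.+1.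
Proof.
by rewrite /adx tau_exp -scalerAl -exprS -exprSr scalerBl scale1r.
Qed.

(** The terms x_i^l (x) a with a an eigenvector form a triangular system under the
adjoint action; the coproducts of ad(x_i)^m (x_j) are computed by iterating it. *)
Lemma adx2_exp l a (k : F) : theta i a = k *: a -> adx2 i (ot (x i ^+ l) a) =
  (1 - Q ^+ l * k) *: ot (x i ^+ l.+1) a + Q ^+ l *: ot (x i ^+ l) (ad a).
Proof.
move=> ka; rewrite adx2_ot adx_gen_exp tau_exp ka.
have -> : a - k *: a = (1 - k) *: a by rewrite scalerBl scale1r.
rewrite -scalerAl -exprSr !(otZl, otZr) addrAC scalerA -scalerDl; congr (_ *: _ + _).
ring.
Qed.

(** Every mixed coefficient of the coproduct of ad(x_i)^m (x_j) has the factor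
1 - Q^(m-1) t with t = q_ij q_ji; for m = 3 this is zero. *)
Lemma serre_primitive :
  comul (iter 3 ad (x j)) = ot (iter 3 ad (x j)) 1 + ot 1 (iter 3 ad (x j)).
Proof.
have := qij; set t := q i j * q j i => qt.
have theta_iter m : theta i (iter m ad (x j)) = (Q ^+ (2 * m) * t) *: iter m ad (x j).
  elim: m => [|m IH] /=; last by rewrite (theta_adx IH) mulrA -exprD mulnS.
  by rewrite theta_tau tau_gen linearZ /= tau'_gen scalerA muln0 mul1r.
have th1 b : adx2 i (ot b 1) = ot (ad b) 1.
  rewrite adx2_ot adx1 theta_tau tau1 tau'1 subrr.
  by rewrite !(linear_zero (ot_linearr _)) !addr0.
have th0 m := adx2_exp 0 (theta_iter m).
have thS l m := adx2_exp l (theta_iter m).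
have adx2D z z' : adx2 i (z + z') = adx2 i z + adx2 i z' by exact: (linear_add (adx2_linear i)).
have adx2Z k z : adx2 i (k *: z) = k *: adx2 i z by exact: (linear_scale (adx2_linear i)).
pose y m := iter m ad (x j); pose X l m := ot (x i ^+ l) (y m).
have adx2X l m : adx2 i (X l m) =
    (1 - Q ^+ l * (Q ^+ (2 * m) * t)) *: X l.+1 m + Q ^+ l *: X l m.+1.
  exact: adx2_exp (theta_iter m).
have h00 : adx2 i (X 0 0) = (1 - t) *: X 1 0 + X 0 1.
  by rewrite adx2X; congr (_ *: _ + _); [ring|exact: scale1r].
have h01 : adx2 i (X 0 1) = (1 - Q ^+ 2 * t) *: X 1 1 + X 0 2.
  by rewrite adx2X; congr (_ *: _ + _); [ring|exact: scale1r].
have h02 : adx2 i (X 0 2) = (1 - Q ^+ 4 * t) *: X 1 2 + X 0 3.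
  by rewrite adx2X; congr (_ *: _ + _); [ring|exact: scale1r].
have h10 : adx2 i (X 1 0) = (1 - Q * t) *: X 2 0 + Q *: X 1 1.
  by rewrite adx2X; congr (_ *: _ + _); ring.
have h11 : adx2 i (X 1 1) = (1 - Q ^+ 3 * t) *: X 2 1 + Q *: X 1 2.
  by rewrite adx2X; congr (_ *: _ + _); ring.
have h20 : adx2 i (X 2 0) = (1 - Q ^+ 2 * t) *: X 3 0 + Q ^+ 2 *: X 2 1.
  by rewrite adx2X; congr (_ *: _ + _); ring.
have comulS m : comul (y m.+1) = adx2 i (comul (y m)) by exact: comul_adx.
have d0 : comul (y 0) = ot (y 0) 1 + X 0 0 by exact: comul_gen.
have d1 : comul (y 1) = ot (y 1) 1 + X 0 1 + (1 - t) *: X 1 0.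
  by rewrite comulS d0 adx2D th1 h00 [_ *: _ + _]addrC addrA.
have d2 : comul (y 2) = ot (y 2) 1 + X 0 2 +
    ((1 - Q ^+ 2 * t + (1 - t) * Q) *: X 1 1 + ((1 - t) * (1 - Q * t)) *: X 2 0).
  rewrite comulS d1 !adx2D adx2Z th1 h01 h10; move: (X 0 2) (X 1 1) (X 2 0) => u v w.
  rewrite [_ *: v + u]addrC (scalerDr (1 - t)) !scalerA [_ *: w + _]addrC.
  by rewrite scalerDl !addrA.
rewrite -/(y 3) comulS d2 !adx2D !adx2Z th1 h02 h11 h20.
rewrite -/(X 0 3); move: (X 0 3) (X 1 2) (X 2 1) (X 3 0) => u a1 a2 a3.
rewrite [1 - Q ^+ 2 * t](_ : _ = 0) ?scale0r ?add0r; last by rewrite qt subrr.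
rewrite !(scalerDr, scalerA).
rewrite [_ *: a1 + u]addrC addrA -[RHS]addr0 -!addrA; congr (_ + (_ + _)).
rewrite (addrCA (_ *: a2)) [LHS]addrA -!scalerDl.
have -> : 1 - Q ^+ 4 * t + (1 - t) * Q * Q = (1 + Q ^+ 2) * (1 - Q ^+ 2 * t) by ring.
have -> : (1 - t) * Q * (1 - Q ^+ 3 * t) + (1 - t) * (1 - Q * t) * Q ^+ 2 =
  (1 - t) * Q * (1 + Q) * (1 - Q ^+ 2 * t) by ring.
by rewrite qt subrr !mulr0 !scale0r addr0.
Qed.
End SerreElement.

(** * Ideals generated by homogeneous primitive elements *)

Section PrimitiveIdeal.
Variable s : seq T.
Hypothesis s_prim : forall r, r \in s -> comul r = ot r 1 + ot 1 r.
Hypothesis s_hom : forall r, r \in s -> exists d, forall g, twist g r = g d *: r.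
Hypothesis s_coef1 : forall r, r \in s -> coef mone r = 0.
Hypothesis s_coef_gen : forall r i, r \in s -> coef (fmu i) r = 0.
(* A variable rather than generated_ideal s itself, so that a goal J a is never
   unfolded into a quantification over ideals. *)
Variable J : T -> Prop.
Hypothesis J_generated : J = generated_ideal s.

Lemma J_ideal : is_ideal J.
Proof. by rewrite J_generated; exact: generated_ideal_is_ideal. Qed.

Lemma mem_J r : r \in s -> J r.
Proof. by rewrite J_generated => rs I _; exact. Qed.

Lemma J_ind (P : T -> Prop) : span_closed P -> (forall r, r \in s -> P r) ->
  (forall w a, J a -> P a -> P (wd w * a)) ->
  (forall w a, J a -> P a -> P (a * wd w)) -> forall a, J a -> P a.
Proof. by rewrite J_generated; exact: generated_ideal_wd_ind. Qed.

Lemma J_span_closed (f : T -> T) : linear f -> span_closed (fun a => J (f a)).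
Proof.
move=> fL; split=> [|k a b Ja Jb]; first by rewrite linear_zero //; exact: (ideal0 J_ideal).
by rewrite fL; apply: (idealD J_ideal) => //; exact: (idealZ J_ideal).
Qed.

Lemma J_twist g a : J a -> J (twist g a).
Proof.
suff : J a -> forall g, J (twist g a) by move=> H Ja; exact: H.
move: a; apply: J_ind => [|r rs h|w a _ Ja h|w a _ Ja h].
- split=> [h|k a b Ja Jb h]; first by rewrite linear0; exact: (ideal0 J_ideal).
  by rewrite linearP; apply: (ideal_lin J_ideal); [exact: Ja|exact: Jb].
- by have [d ->] := s_hom rs; apply/(idealZ J_ideal)/mem_J.
- by rewrite twist_wdl; exact: (idealMl J_ideal).
- by rewrite twist_wdr; exact: (idealMr J_ideal).
Qed.

Lemma J_adx i a : J a -> J (adx i a).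
Proof.
move=> Ja; apply: (idealB J_ideal); first exact: (idealMl J_ideal).
by apply/(idealMr J_ideal)/J_twist.
Qed.

Lemma J_DR i a : J a -> J (DR i a).
Proof.
move: a; apply: J_ind => [|r rs|w a Ja Da|w a Ja Da].
- exact/J_span_closed/linearP.
- rewrite /DR s_prim // linearD /= !rslice_ot coef_gen_1 s_coef_gen //.
  by rewrite !scale0r addr0; exact: (ideal0 J_ideal).
- rewrite DRM; apply: (idealD J_ideal); first exact: (idealMl J_ideal).
  by apply/(idealMl J_ideal)/J_twist.
- rewrite DRM; apply: (idealD J_ideal); first exact: (idealMr J_ideal).
  exact: (idealMr J_ideal).
Qed.

Lemma J_DL i a : J a -> J (DL i a).
Proof.
move: a; apply: J_ind => [|r rs|w a Ja Da|w a Ja Da].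
- exact/J_span_closed/linearP.
- rewrite /DL s_prim // linearD /= !lslice_ot coef_gen_1 s_coef_gen //.
  by rewrite !scale0r addr0; exact: (ideal0 J_ideal).
- rewrite DLM; apply: (idealD J_ideal); first exact: (idealMl J_ideal).
  exact: (idealMl J_ideal).
- rewrite DLM; apply: (idealD J_ideal); first exact: (idealMr J_ideal).
  by apply/(idealMr J_ideal)/J_twist.
Qed.

(** The antipode axiom gives S r = - r for a primitive r. *)
Lemma J_antip a : J a -> J (antip a).
Proof.
suff H : J a -> forall g, J (antip (twist g a)).
  move=> Ja; have := H Ja (fun=> 1); congr (J (antip _)).
  by rewrite twist1.
move: a; apply: J_ind => [|r rs g|w a _ Ja g|w a _ Ja g].
- split=> [g|k a b Ja Jb g]; first by rewrite !linear0; exact: (ideal0 J_ideal).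
  by rewrite !linearP; apply: (ideal_lin J_ideal); [exact: Ja|exact: Jb].
- have [d ->] := s_hom rs; rewrite linearZ /=; apply: (idealZ J_ideal).
  have := antipode_axiom r; rewrite s_prim // linearD /= !mul_antip_ot antip1 mulr1 mul1r.
  rewrite s_coef1 // scale0r => /eqP; rewrite addr_eq0 => /eqP E.
  by rewrite -[antip r]opprK -E; apply/(idealN J_ideal)/mem_J.
- rewrite twist_wdl antip_wdl twist_comp; exact: (idealMr J_ideal).
- rewrite twist_wdr antip_wdr twist_comp; exact: (idealMl J_ideal).
Qed.

Lemma J_coef1 a : J a -> coef mone a = 0.
Proof.
move: a; apply: J_ind => [|r rs|w a _ Ja|w a _ Ja].
- by split=> [|k a b a0 b0]; rewrite ?linear0 // linearP /= a0 b0 mulr0 addr0.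
- exact: s_coef1.
- by rewrite coef1M Ja mulr0.
- by rewrite coef1M Ja mul0r.
Qed.

Lemma cspan_bmull z t : cspan J t -> cspan J (bmul z t).
Proof.
have [c0 cP] := cspan_span_closed J_ideal.
move=> [r rJ ->]; elim/ot_ind: z => [|u v].
  split=> [|k z z' cz cz']; first by rewrite (linear_zero (bmul_linearl _)).
  by rewrite bmulDl bmulZl; exact: cP.
elim: r rJ => [|p r IH] rJ; first by rewrite big_nil (linear_zero (bmul_linearr _)).
rewrite big_cons bmulDr -[bmul _ (ot _ _)]scale1r; apply: cP; last first.
  by apply: IH => p' p'r; apply: rJ; rewrite inE p'r orbT.
rewrite bmul_otl; apply: cspan_ot.
have [Jp|Jp] := rJ p (mem_head _ _); [left|right]; apply: (idealMl J_ideal) => //.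
exact: J_twist.
Qed.

Lemma cspan_bmulr z t : cspan J t -> cspan J (bmul t z).
Proof.
have [c0 cP] := cspan_span_closed J_ideal.
move=> [r rJ ->]; elim/ot_ind: z => [|u v].
  split=> [|k z z' cz cz']; first by rewrite (linear_zero (bmul_linearr _)).
  by rewrite bmulDr bmulZr; exact: cP.
elim: r rJ => [|p r IH] rJ; first by rewrite big_nil (linear_zero (bmul_linearl _)).
rewrite big_cons bmulDl -[bmul (ot _ _) _]scale1r; apply: cP; last first.
  by apply: IH => p' p'r; apply: rJ; rewrite inE p'r orbT.
rewrite bmul_otr; apply: cspan_ot.
have [Jp|Jp] := rJ p (mem_head _ _); [left|right]; apply: (idealMr J_ideal) => //.
exact: J_twist.
Qed.

Lemma J_coideal a : J a -> cspan J (comul a).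
Proof.
have [c0 cP] := cspan_span_closed J_ideal.
move: a; apply: J_ind => [|r rs|w a _ Ja|w a _ Ja].
- by split=> [|k a b ca cb]; rewrite ?linear0 // linearP; exact: cP.
- rewrite s_prim // -[ot r 1]scale1r; apply: cP; apply: cspan_ot; [left|right]; exact: mem_J.
- by rewrite comulM; exact: cspan_bmull.
- by rewrite comulM; exact: cspan_bmulr.
Qed.

Lemma J_coef_gen i a : J a -> coef (fmu i) a = 0.
Proof. by move=> Ja; rewrite -coef_DR; exact/J_coef1/J_DR. Qed.

(** * Quantum sl_2: lowest weight vectors of positive weight vanish *)

Section RankOne.
Variable i : 'I_n.
Local Notation Q := (q i i).
Hypothesis Q_root : forall m, (0 < m)%N -> Q ^+ m != 1.
Local Notation ad := (adx i).

Definition nilp a := exists N, J (iter N ad a).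
Hypothesis nilp_gen : forall j, j != i -> nilp (x j).

Lemma J_iter_adx N a : J a -> J (iter N ad a).
Proof. by move=> Ja; elim: N => //= N; exact: J_adx. Qed.

Lemma iter_adx_linear N : linear (iter N ad).
Proof. by move=> k a b; elim: N => //= N ->; rewrite linearP. Qed.

Lemma J_iter_adx_le M N a : (M <= N)%N -> J (iter M ad a) -> J (iter N ad a).
Proof. by move=> /subnK <-; rewrite iterD; exact: J_iter_adx. Qed.

Lemma nilp_twist g a : nilp a -> nilp (twist g a).
Proof.
move=> [N JN]; exists N; have [h ->] := iter_adx_twist i g N a.
exact: J_twist.
Qed.

Lemma nilpP (k : F) a b : nilp a -> nilp b -> nilp (k *: a + b).
Proof.
move=> [N JN] [M JM]; exists (N + M)%N; rewrite iter_adx_linear.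
apply: (ideal_lin J_ideal); apply: J_iter_adx_le; [|exact: JN| |exact: JM].
  exact: leq_addr.
exact: leq_addl.
Qed.

Lemma J_nilp a : J a -> nilp a.
Proof. by exists 0%N. Qed.

(** The skew Leibniz rule distributes N + M applications of ad x_i over the two
factors. *)
Lemma nilpM a b : nilp a -> nilp b -> nilp (a * b).
Proof.
suff H S N M : (N + M <= S)%N -> forall a b, J (iter N ad a) -> J (iter M ad b) ->
    J (iter S ad (a * b)).
  by move=> [N JN] [M JM]; exists (N + M)%N; exact: (H _ N M).
elim: S N M {a b} => [|S IH] N M.
  by case: N => [|//] _ a b Ja _; exact: (idealMr J_ideal).
case: N => [|N] NM a b JN JM; first by apply/J_iter_adx/(idealMr J_ideal).
case: M NM JM => [|M] NM JM; first by apply/J_iter_adx/(idealMl J_ideal).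
rewrite iterSr adxM (linear_add (iter_adx_linear _)); apply: (idealD J_ideal).
  by apply: (IH N M.+1); rewrite -?iterSr.
apply: (IH N.+1 M); rewrite -?iterSr //; first by rewrite -ltnS -addnS.
have [h ->] := iter_adx_twist i (bichar q (e_ i)) N.+1 a.
exact: J_twist.
Qed.

Definition qnum m : F := \sum_(k < m) Q ^+ k.

Lemma qnumS m : qnum m.+1 = qnum m + Q ^+ m.
Proof. by rewrite /qnum big_ord_recr. Qed.

Lemma qnum_neq0 m : qnum m.+1 != 0.
Proof.
apply/eqP => m0; have := Q_root (ltn0Sn m).
by rewrite -subr_eq0 subrX1 -/(qnum m.+1) m0 mulr0 eqxx.
Qed.

Lemma DR_exp m : DR i (x i ^+ m.+1) = qnum m.+1 *: x i ^+ m.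
Proof.
elim: m => [|m IH]; first by rewrite DR_gen eqxx /qnum big_ord1 scale1r.
rewrite exprS DR_gen_mul IH eqxx scale1r tau_exp -scalerAr -exprS -scalerDl.
by rewrite -qnumS.
Qed.

Lemma DR_sum M (c : nat -> T) : (forall m, DR i (c m) = 0) ->
  DR i (\sum_(m < M.+1) c m * x i ^+ m) =
  \sum_(m < M) (qnum m.+1 *: c m.+1) * x i ^+ m.
Proof.
move=> c0; rewrite linear_sum big_ord_recl /= mulr1 c0 add0r.
by apply: eq_bigr => m _; rewrite DRM c0 mul0r addr0 DR_exp -scalerAl -scalerAr.
Qed.

(** A polynomial in x_i whose coefficients are constants for DR_i lies in J only if
its coefficients do: differentiate, as the quantum integers are invertible. *)
Lemma J_coefs M (c : nat -> T) : (forall m, DR i (c m) = 0) ->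
  J (\sum_(m < M) c m * x i ^+ m) -> forall m, (m < M)%N -> J (c m).
Proof.
elim: M c => [//|M IH] c c0 Jc.
have Jc' m : (m < M)%N -> J (c m.+1).
  move=> mM; apply: (ideal_unscale J_ideal (qnum_neq0 m)).
  apply: (IH (fun m => qnum m.+1 *: c m.+1)) => // [l|].
    by rewrite linearZ /= c0 scaler0.
  by rewrite -DR_sum //; exact: J_DR.
case=> [_|m]; last exact: Jc'.
move: Jc; rewrite big_ord_recl mulr1; apply: (ideal_addr J_ideal).
by apply: (ideal_sum J_ideal) => m _; apply: (idealMr J_ideal); exact: Jc'.
Qed.

(** The elements with DR_i = 0 that are ad x_i-nilpotent modulo J form a subalgebra
containing the other generators, and x_i k = ad x_i (k) + tau_i (k) x_i moves the
powers of x_i to the right of them. *)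
Lemma kernel_decomposition a : exists2 p : {poly T},
  forall m, DR i p`_m = 0 /\ nilp p`_m & a = p.[x i].
Proof.
elim/gen_ind: a => [k a b [p Kp ->] [r Kr ->]||j a [p Kp ->]].
- exists ((k *: 1)%:P * p + r); last first.
    by rewrite hornerD hornerCM mulr_algl.
  move=> m; have [[p0 pN] [r0 rN]] := (Kp m, Kr m).
  rewrite coefD coefCM mulr_algl; split; last exact: nilpP.
  by rewrite linearP /= p0 r0 scaler0 addr0.
- exists 1%:P; rewrite ?hornerC // => m; rewrite coefC.
  case: ifP => _; rewrite ?DR1 ?linear0; split=> //; last exact/J_nilp/(ideal0 J_ideal).
  by exists 1%N; rewrite /= adx1; exact: (ideal0 J_ideal).
have [->{j}|ji] := eqVneq j i; last first.
  exists ((x j)%:P * p); rewrite ?hornerCM // => m; rewrite coefCM.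
  have [p0 pN] := Kp m; split; last exact: nilpM (nilp_gen ji) pN.
  by rewrite DR_gen_mul p0 mulr0 (negPf ji) scale0r addr0.
exists (map_poly ad p + map_poly (tau i) p * 'X); last first.
  rewrite hornerD hornerMX; elim/poly_ind: p {Kp} => [|p c IH].
    by rewrite !map_poly0 !horner0 mulr0 mul0r addr0.
  have mapMXD (f : {additive T -> T}) : map_poly f (p * 'X + c%:P) =
      map_poly f p * 'X + (f c)%:P.
    by apply/polyP => -[|m]; rewrite !(coef_map, coefD, coefMX, coefC) /= ?raddfD ?raddf0.
  rewrite !mapMXD !(hornerD, hornerMX, hornerC) mulrDr mulrA IH /= !mulrDl.
  have -> : x i * c = ad c + tau i c * x i by rewrite subrK.
  by rewrite addrACA.
move=> m; rewrite coefD coefMX !coef_map.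
have KD b c : DR i b = 0 /\ nilp b -> DR i c = 0 /\ nilp c ->
    DR i (b + c) = 0 /\ nilp (b + c).
  move=> [b0 bN] [c0 cN]; rewrite linearD /= b0 c0 addr0; split=> //.
  by rewrite -[b]scale1r; exact: nilpP.
apply: KD.
  have [p0 [N pN]] := Kp m; split; first exact: DR_adx.
  by exists N; rewrite -iterSr /=; exact: J_adx.
case: m => [|m] /=; first by rewrite linear0; split=> //; exact/J_nilp/(ideal0 J_ideal).
have [p0 pN] := Kp m; split; last exact: nilp_twist.
by rewrite /tau /= DR_twist p0 linear0.
Qed.

(** All coefficients but the constant one of the decomposition of a lie in J. *)
Lemma J_DR_nilp a : J (DR i a) -> nilp a.
Proof.
have [p Kp ->] := kernel_decomposition a; rewrite horner_coef.
case: (size p) => [|M]; first by rewrite big_ord0 => _; exact/J_nilp/(ideal0 J_ideal).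
have p0 m : DR i p`_m = 0 by have [] := Kp m.
rewrite DR_sum // big_ord_recl mulr1 => Jp.
rewrite -[p`_0]scale1r; apply: nilpP; first by have [] := Kp 0%N.
apply/J_nilp/(ideal_sum J_ideal) => m _; apply: (idealMr J_ideal).
apply: (ideal_unscale J_ideal (qnum_neq0 m)).
apply: (J_coefs (c := fun m => qnum m.+1 *: p`_m.+1) _ Jp) => // l.
by rewrite linearZ /= p0 scaler0.
Qed.

(** The quantum analogue of f e^(N+1) v = (N + 1) (weight + N) e^N v, up to sign, for
a lowest weight vector v. *)
Lemma DL_iter_adx a (k : F) N : theta i a = k *: a -> J (DL i a) ->
  J (DL i (iter N.+1 ad a) - (qnum N.+1 * (1 - k * Q ^+ N)) *: iter N ad a).
Proof.
move=> ka Ja.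
have theta_iter m : theta i (iter m ad a) = (Q ^+ (2 * m) * k) *: iter m ad a.
  elim: m => [|m IH] /=; first by rewrite muln0 mul1r.
  by rewrite (theta_adx IH) mulrA -exprD mulnS.
elim: N => [|N IH].
  rewrite /= DL_adx // ka /qnum big_ord1 !expr0 mul1r mulr1 scalerBl scale1r addrC addKr.
  by apply/(idealZ J_ideal)/J_adx.
rewrite [iter N.+2 _ _]iterS DL_adx // theta_iter.
have: ad (iter N ad a) = iter N.+1 ad a by [].
move: (iter N.+1 ad a) (iter N ad a) IH => b e IH be.
have -> : qnum N.+2 * (1 - k * Q ^+ N.+1) =
    1 - Q ^+ (2 * N.+1) * k + Q * (qnum N.+1 * (1 - k * Q ^+ N)).
  have r1 := qnumS N.+1.
  have r2 : qnum N.+1 + Q ^+ N.+1 = 1 + Q * qnum N.+1.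
    rewrite -r1 /qnum big_ord_recl mulr_sumr expr0; congr (_ + _).
    by apply: eq_bigr => m _; rewrite -exprS.
  rewrite mulrBr mulr1 {1}r1 r2 r1 mul2n -addnn exprD !exprS; ring.
have -> : b - (Q ^+ (2 * N.+1) * k) *: b + Q *: ad (DL i b) -
    (1 - Q ^+ (2 * N.+1) * k + Q * (qnum N.+1 * (1 - k * Q ^+ N))) *: b =
    Q *: ad (DL i b - (qnum N.+1 * (1 - k * Q ^+ N)) *: e).
  rewrite [ad (_ - _)]linearB /= (linear_scale (adx_linear i)) be.
  move: (ad (DL i b)) => f; rewrite scalerBr scalerA scalerDl scalerBl scale1r.
  by rewrite opprD addrACA subrr add0r.
by apply/(idealZ J_ideal)/J_adx.
Qed.

(** Since DL_iter_adx has an invertible scalar, ad(x_i)^(N+1) a in J implies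
ad(x_i)^N a in J. *)
Lemma J_lowest_weight a (k : F) : (forall m, k * Q ^+ m != 1) -> theta i a = k *: a ->
  J (DL i a) -> J (DR i a) -> J a.
Proof.
move=> kQ ka DLa /J_DR_nilp [N]; elim: N => [//|N IH JN]; apply: IH.
have := DL_iter_adx N ka DLa.
move=> /(idealB J_ideal (J_DL i JN)); rewrite opprB addrC subrK.
apply: (ideal_unscale J_ideal); apply: mulf_neq0; first exact: qnum_neq0.
by rewrite subr_eq0 eq_sym.
Qed.

End RankOne.

(** * Elements of a coideal are primitive modulo lower degrees *)

Section Descent.
Variable N : T -> Prop.
Hypothesis N_ideal : is_ideal N.
Hypothesis N_coef1 : forall a, N a -> coef mone a = 0.
Hypothesis N_coef_gen : forall i a, N a -> coef (fmu i) a = 0.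
Hypothesis N_coideal : forall a, N a -> cspan N (comul a).

Lemma N_DR i a : N a -> N (DR i a).
Proof.
move=> /N_coideal [r rN E]; rewrite /DR E linear_sum big_seq.
apply: (ideal_sum N_ideal) => p /rN Np; rewrite /= rslice_ot.
case: Np => Np; first exact: (idealZ N_ideal).
by rewrite N_coef_gen // scale0r; exact: (ideal0 N_ideal).
Qed.

Lemma N_DL i a : N a -> N (DL i a).
Proof.
move=> /N_coideal [r rN E]; rewrite /DL E linear_sum big_seq.
apply: (ideal_sum N_ideal) => p /rN Np; rewrite /= lslice_ot.
case: Np => Np; last exact: (idealZ N_ideal).
by rewrite N_coef_gen // scale0r; exact: (ideal0 N_ideal).
Qed.

(** In the antipode axiom for a, projected to degree d, a summand b S(c) whose two
factors have positive degree lies in J, by the assumption on the factor that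
belongs to N.  The two extreme terms give the projection of a and its antipode. *)
Lemma antip_opp_mod_J d a : N a ->
  (forall d' b, ht d' < ht d -> N b -> J (proj d' b)) ->
  J (proj d a + antip (proj d a)).
Proof.
move=> Na IH; have [r rN E] := N_coideal Na.
have J0 := ideal0 J_ideal; have JP := ideal_lin J_ideal.
(* The part of a summand that remains after the two extreme terms. *)
pose h b c := proj d (b * antip c) - coef mone c *: proj d b -
  coef mone b *: antip (proj d c).
have hl c : linear (h^~ c).
  move=> k b b'; rewrite /h mulrDl -scalerAl !linearP /= !(scalerDr, scalerN, scalerDl).
  by rewrite !scalerA !opprD (addrACA (k *: proj d _)) [LHS]addrACA.
have hr b : linear (h b).
  move=> k c c'; rewrite /h !linearP /= mulrDr -scalerAr !linearP /=.
  rewrite !(scalerDr, scalerN, scalerDl) !scalerA !opprD.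
  by rewrite (addrACA (k *: proj d _)) [LHS]addrACA.
have smaller w : (w == mone) = false -> ht (d - wdeg w) < ht d.
  move=> w1; rewrite htD htN ht_wdeg ltrBlDr ltrDl ltz_nat lt0n fdeg_eq0.
  by rewrite w1.
have hJ b c : N b \/ N c -> J (h b c).
  case=> [Nb|Nc].
    elim/wd_ind: c => [|w].
      by split=> [|k c c' Jc Jc']; rewrite ?(linear_zero (hr b)) // hr; exact: JP.
    rewrite /h (N_coef1 Nb) scale0r subr0 coef_wd; case: eqP => [->|/eqP w1].
      by rewrite (wd1 D) antip1 mulr1 scale1r subrr.
    rewrite scale0r subr0 /proj twist_mul_antip; apply: (idealMr J_ideal).
    have -> b' : twist (fun d' => (d' + wdeg w == d)%:R) b' = proj (d - wdeg w) b'.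
      by apply: eq_twist => d'; rewrite -subr_eq opprK.
    by apply: IH => //; apply/smaller/negbTE.
  elim/wd_ind: b => [|w].
    by split=> [|k b b' Jb Jb']; rewrite ?(linear_zero (hl c)) // hl; exact: JP.
  rewrite /h (N_coef1 Nc) scale0r subr0 coef_wd; case: eqP => [->|/eqP w1].
    by rewrite (wd1 D) mul1r scale1r /proj antip_twist subrr.
  rewrite scale0r subr0 /proj twist_wdl -antip_twist.
  apply/(idealMl J_ideal)/J_antip.
  have -> b' : twist (fun d' => (wdeg w + d' == d)%:R) b' = proj (d - wdeg w) b'.
    by apply: eq_twist => d'; rewrite addrC -subr_eq opprK.
  by apply: IH => //; apply/smaller/negbTE.
have Jsum : J (\sum_(p <- r) h p.1 p.2).
  by rewrite big_seq; apply: (ideal_sum J_ideal) => p /rN; exact: hJ.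
have := antipode_axiom a; rewrite (N_coef1 Na) scale0r E linear_sum /= => E0.
have Er := rcounit a; have El := lcounit a.
rewrite E linear_sum /= in Er; rewrite E linear_sum /= in El.
have <- : - \sum_(p <- r) h p.1 p.2 = proj d a + antip (proj d a).
  rewrite -{1}Er -{1}El /h !sumrB -[\sum_(p <- r) proj d _]linear_sum.
  rewrite (eq_bigr _ (fun p _ => esym (mul_antip_ot p.1 p.2))) E0 linear0 sub0r opprB.
  rewrite opprK addrC !linear_sum /=; congr (_ + _); apply: eq_bigr => p _.
    by rewrite rslice_ot linearZ.
  by rewrite lslice_ot !linearZ.
exact: (idealN J_ideal).
Qed.

End Descent.
End PrimitiveIdeal.
End Braided.

(** * The Nichols ideal is contained in the Serre ideal *)

Section RankTwo.
Variables (F : fieldType) (D : tensor_model F 2) (r : F).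
Hypothesis r_neq0 : r != 0.
Hypothesis r_root : forall m, (0 < m)%N -> r ^+ m != 1.
Local Notation q := (braiding_matrix r).
Local Notation T := (TA D).
Local Notation x := (gen D).
Implicit Type d : 'rV[int]_2.

Lemma braiding_neq0 i j : q i j != 0.
Proof. by rewrite mxE; do 2?case: ifP => _; rewrite ?invr_eq0 ?oppr_eq0. Qed.

Lemma I2_cases (P : 'I_2 -> Prop) : P 0 -> P 1 -> forall i, P i.
Proof.
move=> P0 P1 i; have [->|i1] := eqVneq i 0; first exact: P0.
suff -> : i = 1 by exact: P1.
by apply/val_inj; case: i i1 => [[|[|]]].
Qed.

Lemma bichar_gen_l i d : bichar q (e_ i) d = q i 0 ^ d 0 0 * q i 1 ^ d 0 1.
Proof.
rewrite bichar_genl !big_ord_recl big_ord0 mulr1.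
by congr (_ ^ d 0 _ * q i _ ^ d 0 _); apply/val_inj.
Qed.

Lemma bichar_gen_r i d : bichar q d (e_ i) = bichar q (e_ i) d.
Proof.
rewrite /bichar exchange_big; apply: eq_bigr => k _; apply: eq_bigr => l _.
by rewrite mulrC; congr (_ ^ _); rewrite !mxE eq_sym; case: eqP => [->|].
Qed.

Lemma bichar_gen0 d : bichar q (e_ 0) d = r ^ (d 0 0 - d 0 1).
Proof. by rewrite bichar_gen_l !mxE /= expfzDr // exprz_inv. Qed.

Lemma bichar_gen1 d : bichar q (e_ 1) d = r ^ (- d 0 0) * (- r) ^ d 0 1.
Proof. by rewrite bichar_gen_l !mxE /= exprz_inv. Qed.

Definition serre_elements : seq T := [:: iter 3 (adx q 0) (x 1); iter 3 (adx q 1) (x 0)].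

Lemma serre_elementsP (P : T -> Prop) :
  P (iter 3 (adx q 0) (x 1)) -> P (iter 3 (adx q 1) (x 0)) ->
  forall s, s \in serre_elements -> P s.
Proof. by move=> P0 P1 s; rewrite !inE => /orP[] /eqP ->. Qed.

Lemma serre_elements_primitive s : s \in serre_elements -> comul q s = ot s 1 + ot 1 s.
Proof.
move: s; apply: serre_elementsP; apply: serre_primitive; try exact: braiding_neq0.
all: rewrite !mxE /= ?sqrrN -expr2 -exprMn divff ?expr1n //.
Qed.

Lemma serre_elements_homogeneous s : s \in serre_elements ->
  exists d, forall g, twist g s = g d *: s.
Proof.
have hom i j : exists d, forall g, twist g (iter 3 (adx q i) (x j)) =
    g d *: iter 3 (adx q i) (x j).
  exists (e_ j + e_ i + e_ i + e_ i) => /=.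
  do 3!apply: adx_homogeneous.
  by move=> g; rewrite twist_wd wdeg_gen.
by move: s; apply: serre_elementsP.
Qed.

Lemma serre_elements_coef1 s : s \in serre_elements -> coef mone s = 0.
Proof. by move: s; apply: serre_elementsP; exact: coef1_adx. Qed.

Lemma serre_elements_coef_gen s i : s \in serre_elements -> coef (fmu i) s = 0.
Proof. by move: s; apply: serre_elementsP; apply: coef_gen_adx; exact: braiding_neq0. Qed.

Lemma Nr_root m : (0 < m)%N -> (- r) ^+ m != 1.
Proof.
move=> m0; apply/eqP => E; have := @r_root (m * 2) _.
by rewrite muln_gt0 m0 exprM -[r]opprK exprNn E mulr1 -exprM mulnC exprM sqrrN !expr1n eqxx => /(_ isT).
Qed.

Lemma NexpzD (k : int) : (- r) ^ (k + k) = r ^ (k + k).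
Proof. by rewrite !expfzDr ?oppr_eq0 // -!expfzMl mulrNN. Qed.

Lemma exprz_root (z : int) : z != 0 -> r ^ z != 1.
Proof. by case: z => n n0; rewrite ?invr_eq1; apply: r_root; rewrite ?lt0n. Qed.

Section Inclusion.
Implicit Type a : T.
Variable N : T -> Prop.
Hypothesis N_ideal : is_ideal N.
Hypothesis N_coef1 : forall a, N a -> coef mone a = 0.
Hypothesis N_coef_gen : forall i a, N a -> coef (fmu i) a = 0.
Hypothesis N_coideal : forall a, N a -> cspan N (comul q a).
Local Notation J := (generated_ideal serre_elements).
Local Notation J_ideal := (generated_ideal_is_ideal serre_elements).

(** The scalar chi (d, d) / (q_00^(d_0) q_11^(d_1)): the signs of q_11 = - q cancel
because d_1^2 and d_1 have the same parity. *)
Definition antip_sqr_scalar d : F := r ^ ((d 0 0 - d 0 1) ^+ 2 - d 0 0 - d 0 1).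

Lemma antip_sqr_scalarD i d : antip_sqr_scalar (d + e_ i) =
  bichar q (e_ i) d * bichar q d (e_ i) * antip_sqr_scalar d.
Proof.
rewrite bichar_gen_r /antip_sqr_scalar; elim/I2_cases: i.
  rewrite bichar_gen0 -!expfzDr // !mxE /=; congr (_ ^ _); ring.
rewrite bichar_gen1 !mxE /= mulrACA -!expfzDr ?oppr_eq0 // NexpzD.
rewrite -!expfzDr //; congr (_ ^ _); ring.
Qed.

Lemma theta_proj i d a : theta q i (proj d a) =
  r ^ (if i == 0 then (d 0 0 - d 0 1) *+ 2 else (d 0 1 - d 0 0) *+ 2) *: proj d a.
Proof.
rewrite /theta twist_proj bichar_gen_r; congr (_ *: _); elim/I2_cases: i.
  by rewrite bichar_gen0 -expfzDr.
rewrite bichar_gen1 mulrACA -!expfzDr ?oppr_eq0 // NexpzD.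
by rewrite -expfzDr //; congr (_ ^ _); rewrite /=; ring.
Qed.

Lemma serre_nilp i j : j != i -> nilp q J i (x j).
Proof.
move=> ji; exists 3 => I _ sI; apply: sI; rewrite !inE.
by elim/I2_cases: i ji; elim/I2_cases: j => //=; rewrite eqxx ?orbT.
Qed.

Lemma braiding_diag_root i : forall m, (0 < m)%N -> q i i ^+ m != 1.
Proof.
by elim/I2_cases: i => m m0; rewrite mxE /=; [exact: r_root|exact: Nr_root].
Qed.

Lemma expNr_root (k : nat) m : (0 < k)%N -> (- r) ^+ m * r ^+ (k.*2) != 1.
Proof.
move=> k0; rewrite -mul2n exprM -sqrrN -exprM -exprD; apply: Nr_root.
by rewrite addn_gt0 muln_gt0 k0 orbT.
Qed.

(** The index i with the larger d_i has weight 2 (d_i - d_j) > 0, which excludes a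
nonzero lowest weight vector. *)
Lemma J_proj_unbalanced d a : d 0 0 != d 0 1 ->
  (forall i, J (DL q i (proj d a))) -> (forall i, J (DR q i (proj d a))) -> J (proj d a).
Proof.
move=> d01 JL JR.
have lowest i k : (forall m, k * q i i ^+ m != 1) ->
    theta q i (proj d a) = k *: proj d a -> J (proj d a).
  by move=> kQ ka; exact: (J_lowest_weight braiding_neq0 serre_elements_primitive
    serre_elements_homogeneous serre_elements_coef_gen (erefl J) (@braiding_diag_root i)
    (@serre_nilp i) kQ ka (JL i) (JR i)).
case: (ltgtP (d 0 0) (d 0 1)) d01 => // dlt _.
- refine (lowest 1 _ _ (theta_proj 1 d a)) => m /=.
  have [k Ek] : exists k : nat, (d 0 1 - d 0 0) *+ 2 = (k.+1.*2)%:Z.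
    by exists `|(d 0 1 - d 0 0)%R|%N.-1; move: dlt; lia.
  by rewrite Ek -exprnP mxE /= mulrC; exact: expNr_root.
- refine (lowest 0 _ _ (theta_proj 0 d a)) => m /=.
  have [k Ek] : exists k : nat, (d 0 0 - d 0 1) *+ 2 = (k.+1)%:Z.
    by exists `|((d 0 0 - d 0 1) *+ 2)%R|%N.-1; move: dlt; lia.
  by rewrite Ek -exprnP mxE /= -exprD; exact: r_root.
Qed.

(** Degree 0 has to be treated apart: there the scalar of the squared antipode is 1,
and the projection vanishes because the counit does. *)
Lemma J_proj d a : N a -> J (proj d a).
Proof.
suff H m : forall d a, ht d < m%:Z -> N a -> J (proj d a).
  by apply: (H `|ht d|.+1); lia.
elim: m => [|m IH] {}d {}a dm Na; first by rewrite proj_ht_lt0 //; exact: (ideal0 J_ideal).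
have JD (f : T -> T) (i : 'I_2) : f (proj d a) = proj (d - e_ i) (f a) -> N (f a) -> J (f (proj d a)).
  by move=> -> Nf; apply: IH => //; rewrite htD htN ht_gen; lia.
have proj_shift i b : twist (fun d' => (d' + e_ i == d)%:R) b = proj (d - e_ i) b.
  by apply: eq_twist => d'; rewrite -subr_eq opprK.
have [d01|d01] := eqVneq (d 0 0) (d 0 1); last first.
  apply: J_proj_unbalanced => // i.
    by apply: (JD _ i); [rewrite /proj DL_twist proj_shift|exact: N_DL].
  by apply: (JD _ i); [rewrite /proj DR_twist proj_shift|exact: N_DR].
have [d0|d_neq0] := eqVneq (d 0 0) 0.
  have -> : d = 0 by apply/rowP => i; elim/I2_cases: i; rewrite mxE -?d01.
  by rewrite proj0 N_coef1 // scale0r; exact: (ideal0 J_ideal).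
have Jadd : J (proj d a + antip q (proj d a)).
  apply: (antip_opp_mod_J braiding_neq0 serre_elements_primitive
    serre_elements_homogeneous serre_elements_coef1 (erefl J) N_coef1 N_coideal) => //.
  by move=> d' b d'd; apply: IH; move: d'd dm; lia.
have := J_antip braiding_neq0 serre_elements_primitive
    serre_elements_homogeneous serre_elements_coef1 (erefl J) Jadd.
rewrite linearD /= (antip_sqr braiding_neq0 _ _ antip_sqr_scalarD); last first.
  by rewrite /antip_sqr_scalar !mxE.
rewrite twist_proj => /(idealB J_ideal Jadd).
rewrite addrKA -{1}[proj d a]scale1r -scalerBl.
apply: (ideal_unscale J_ideal); rewrite subr_eq0 eq_sym /antip_sqr_scalar d01 subrr expr0n sub0r.
by apply: exprz_root; move: d_neq0; rewrite d01; lia.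
Qed.

Lemma nichols_in_serre a : N a -> J a.
Proof.
move=> Na; have [s su Es] := sum_proj a.
rewrite (Es s) //; apply: (ideal_sum J_ideal) => d _; exact: J_proj.
Qed.
End Inclusion.
(** Both sides are combinations of the words with three letters B and one A.  Their
coefficients are, up to sign, the elementary symmetric functions of the numbers
q^-1, -1, q, read in opposite orders; they agree since these numbers have product
-1 and are permuted by inversion. *)
Lemma iter_radx_eq_adx : iter 3 (radx q 1) (x 0) = iter 3 (adx q 1) (x 0).
Proof.
have q0 := braiding_neq0; have q10 : q 1 0 = r^-1 by rewrite mxE.
have q01 : q 0 1 = r^-1 by rewrite mxE.
have q11 : q 1 1 = - r by rewrite mxE.
have q11' : - r * r^-1 = -1 by rewrite mulNr divff.
set A := x 0; set B := x 1; pose p := r^-1.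
have EA : tau q 1 A = p *: A by rewrite tau_gen // q10.
have RA : tau' q 1 A = p *: A by rewrite tau'_gen // q01.
have EA1 := tau_adx q0 EA; have EA2 := tau_adx q0 EA1.
have RA1 := tau'_radx q0 RA; have RA2 := tau'_radx q0 RA1.
rewrite q11 q11' in EA1 EA2 RA1 RA2; rewrite mulrN1 opprK in EA2 RA2.
rewrite /= (adx_eigen EA2) (radx_eigen RA2) (adx_eigen EA1) (radx_eigen RA1).
rewrite (adx_eigen EA) (radx_eigen RA) -/B {EA RA EA1 RA1 EA2 RA2}.
pose C a b c : T := a *: (B * B * A) + b *: (B * A * B) + c *: (A * B * B).
have -> : B * (B * A - p *: (A * B)) - -1 *: ((B * A - p *: (A * B)) * B) = C 1 (1 - p) (- p).
  rewrite scaleN1r opprK mulrBr mulrBl -scalerAr -scalerAl !mulrA /C scale1r scaleNr.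
  by rewrite scalerBl scale1r -addrA [- _ + (_ - _)]addrA [- _ + _]addrC addrA.
have -> : (A * B - p *: (B * A)) * B - -1 *: (B * (A * B - p *: (B * A))) = C (- p) (1 - p) 1.
  rewrite scaleN1r opprK mulrBr mulrBl -scalerAr -scalerAl !mulrA /C scale1r scaleNr.
  rewrite scalerBl scale1r; move: (A * B * B) (B * A * B) (B * B * A) => u v w.
  by rewrite addrC [v - _]addrC !addrA addrAC.
rewrite /C !mulrDr !mulrDl -!scalerAr -!scalerAl !scalerDr !scalerA !mulrA.
move: (B * B * B * A) (B * B * A * B) (B * A * B * B) (A * B * B * B) => m0 m1 m2 m3.
have comb a0 a1 a2 b1 b2 b3 :
    a0 *: m0 + a1 *: m1 + a2 *: m2 - (b1 *: m1 + b2 *: m2 + b3 *: m3) =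
    a0 *: m0 + (a1 - b1) *: m1 + (a2 - b2) *: m2 - b3 *: m3.
  by rewrite !scalerBl !opprD !addrA; congr (_ - _); congr (_ - _); rewrite addrAC.
rewrite -opprB !comb !opprD -!scaleNr.
have rp : r * p = 1 by rewrite divff.
by congr (_ *: _ + _ *: _ + _ *: _ + _ *: _); rewrite ?mulrBr ?mulrN rp; ring.
Qed.

End RankTwo.

(** * The free algebra as a model, and the theorem *)

Section Concrete.
Variables (F : fieldType) (n : nat).
Local Notation W := {fmonom 'I_n}.
Local Notation T := (tensor_alg F n).
Local Notation T2 := (tensor_alg2 F n).

Lemma malg_span (K : choiceType) (P : {malg F[K]} -> Prop) :
  span_closed P -> (forall k, P << k >>) -> forall a, P a.
Proof.
move=> [P0 PD] PU a; rewrite (monalgE a); elim/big_ind: _ => // [x y Px Py|k _].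
  by rewrite -[x]scale1r; exact: PD.
have -> : << a@_k *g k >> = a@_k *: << k >> + 0 :> {malg F[K]}.
  by apply/malgP => l; rewrite addr0 mcoeffZ !mcoeffU mulr_natr.
exact: PD.
Qed.

Lemma linext2_linear (K L : choiceType) (M : lmodType F) (h : K -> L -> M) a :
  linear (fun b => linext (fun u => linext (h u) b) a).
Proof.
move=> k b c; rewrite /(linext _ a) /linext scaler_sumr -big_split.
apply: eq_bigr => u _ /=; rewrite -!/(linext _ _) linearP scalerDr.
by rewrite !scalerA mulrC.
Qed.

Lemma word_mul (u w : W) : << u ** w >> = << u >> * << w >> :> T.
Proof.
by apply: esym; rewrite [_ * _]malgM_def /fgmul !msuppU1 !big_seq_fset1 !mcoeffUU mulr1.
Qed.

Lemma tens_word (u w : W) : tens (<< u >> : T) << w >> = << (u, w) >>.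
Proof. by rewrite /tens !linextU. Qed.

Lemma tens_ind (P : T2 -> Prop) : span_closed P ->
  (forall u w : W, P (tens << u >> << w >>)) -> forall z, P z.
Proof. by move=> Pc PU; apply: malg_span => // -[u w]; rewrite -tens_word. Qed.

Lemma linext_tens (M : lmodType F) (h : W -> W -> M) u w :
  linext (fun p => h p.1 p.2) (tens (<< u >> : T) << w >>) = h u w.
Proof. by rewrite tens_word linextU. Qed.

Definition word_model : tensor_model F n := @TensorModel F n
  (tensor_alg F n) (tensor_alg2 F n)
  (fun w => << w >>) (@tens F n) erefl word_mul (@malg_span _)
  (fun M => @linext F W M) (fun M => @linext_is_linear F W M)
  (fun M => @linextU F W M)
  (fun b => @linext_is_linear F W T2 _) (@linext2_linear _ _ _ _)
  tens_ind (fun M h => linext (fun p => h p.1 p.2))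
  (fun M h => @linext_is_linear F _ M _) (@linext_tens).

Local Notation D := word_model.
Variable q : 'M[F]_n.

Lemma braided_mul_word_model (z t : T2) : @bmul F n D q z t = braided_mul q z t.
Proof.
move: z; apply: (@ot_linear_ext F n D) => [||u v]; [exact: bmul_linearl|exact: linext_is_linear|].
move: t; apply: (@ot_linear_ext F n D) => [||w w']; [exact: bmul_linearr|exact: linext2_linear|].
by rewrite bmul_wd /braided_mul /= !tens_word !linextU /=.
Qed.

Lemma comult_word_model (a : T) : @comul F n D q a = comult q a.
Proof.
move: a; apply: (@wd_linear_ext F n D) => [||w]; [exact: linearP|exact: linext_is_linear|].
rewrite /comul lext_wd [RHS]linextU /comult_word.
have eq_foldr (f g : 'I_n -> T2 -> T2) z s : f =2 g -> foldr f z s = foldr g z s.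
  by move=> fg; elim: s => //= i s ->.
by refine (eq_foldr _ _ _ _ _) => i z; rewrite braided_mul_word_model.
Qed.

Lemma coef_word_model v (a : T) : @coef F n D v a = a@_v.
Proof.
elim/(@wd_ind F n D): a => [|w]; last by rewrite coef_wd mcoeffU1.
split=> [|k a b Ea Eb]; first by rewrite linear0 mcoeff0.
by rewrite linearP mcoeffD mcoeffZ -Ea -Eb.
Qed.

Lemma bracket_gen_l i (b : T) : bracket q (tgen F i) b = @adx F n D q i b.
Proof.
move: b; apply: (@wd_linear_ext F n D) => [||w].
- exact: (@linext2_linear _ _ _ (fun u w : W => << u >> * << w >> -
    bichar q (wdeg u) (wdeg w) *: (<< w >> * << u >>) : T)).
- exact: linearP.
by rewrite /bracket /= !linextU /adx tau_wd /chi -scalerAl.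
Qed.

Lemma bracket_gen_r i (a : T) : bracket q a (tgen F i) = @radx F n D q i a.
Proof.
move: a; apply: (@wd_linear_ext F n D) => [||w]; first exact: linext_is_linear.
  move=> k a b; rewrite /radx linearP /= mulrDl mulrDr -scalerAl -scalerAr scalerBr.
  by rewrite opprD addrACA.
by rewrite /bracket /= !linextU /radx tau'_wd /chi -scalerAr.
Qed.

End Concrete.

Section Main.
Variables (F : fieldType) (r : F).
Hypothesis r_neq0 : r != 0.
Hypothesis r_root : forall m, (0 < m)%N -> r ^+ m != 1.
Local Notation q := (braiding_matrix r).
Local Notation D := (word_model F 2).
Local Notation T := (tensor_alg F 2).

Lemma serre_relationsE : serre_relations r = @serre_elements F D r.
Proof.
have El b : bracket q (x1 F) b = @adx F 2 D q 0 b by exact: bracket_gen_l.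
have Er b : bracket q b (x2 F) = @radx F 2 D q 1 b by exact: bracket_gen_r.
congr [:: _; _].
  exact: (etrans (El _) (congr1 _ (etrans (El _) (congr1 _ (El _))))).
apply: etrans (iter_radx_eq_adx D r_neq0).
exact: (etrans (Er _) (congr1 _ (etrans (Er _) (congr1 _ (Er _))))).
Qed.

(** The Serre ideal is one of the coideals over which the Nichols ideal is the
union. *)
Lemma serre_sub_nichols (a : T) : serre_ideal r a -> nichols_ideal q a.
Proof.
have q0 : forall i j, q i j != 0 by exact: braiding_neq0.
have prim := @serre_elements_primitive F D r r_neq0.
have hom := @serre_elements_homogeneous F D r.
have c1 := @serre_elements_coef1 F D r.
have cg := @serre_elements_coef_gen F D r r_neq0.
rewrite /serre_ideal serre_relationsE; apply: nichols_ideal_max; split.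
- exact: generated_ideal_is_ideal.
- split=> b Jb; first by rewrite /counit -coef_word_model; exact: (J_coef1 c1 erefl Jb).
  by rewrite -comult_word_model; exact: (J_coideal q0 prim hom erefl Jb).
move=> b Jb w; apply: contraLR; rewrite -ltnNge -mcoeff_eq0 -coef_word_model => w2.
elim/word_ind: w w2 => [_|i w _].
  by rewrite (J_coef1 c1 erefl Jb).
rewrite fdegM fdegU add1n !ltnS leqn0 fdeg_eq0 => /eqP->.
by rewrite mulm1 (J_coef_gen q0 prim hom c1 cg erefl i Jb).
Qed.

Lemma nichols_sub_serre (a : T) : nichols_ideal q a -> serre_ideal r a.
Proof.
have [Nid [N1 Nco] N2] := nichols_ideal_candidate q.
rewrite /serre_ideal serre_relationsE.
refine (fun Na => @nichols_in_serre F D r r_neq0 r_root (nichols_ideal q) Nid _ _ _ a Na).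
- by move=> b Nb; rewrite coef_word_model; exact: N1.
- move=> i b Nb; rewrite coef_word_model; apply: mcoeff_outdom.
  by apply/negP => /(N2 _ Nb); rewrite fdegU.
- by move=> b /Nco; rewrite comult_word_model.
Qed.

Lemma nichols_generated : generates_algebra [:: nichols_pr q (x1 F); nichols_pr q (x2 F)].
Proof.
move=> P [P1 PD PM PZ] Px a; have [t ->] := alg_pr_surj a.
refine (@gen_ind F 2 D (fun t => P (nichols_pr q t)) _ _ _ t) => [k b c Pb Pc||i b Pb].
- by rewrite linearP; apply: PD => //; exact: PZ.
- by rewrite rmorph1.
rewrite rmorphM; apply: PM => //; apply: Px.
by elim/I2_cases: i; rewrite !inE eqxx ?orbT.
Qed.

End Main.

Theorem theorem4p1 (R : realType) (q : complex R) (q_neq0 : q != 0)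
    (q_not_root_of_unity : forall m : nat, (0 < m)%N -> q ^+ m != 1) :
  [/\ generates_algebra
        [:: nichols_pr (braiding_matrix q) (x1 (complex R));
            nichols_pr (braiding_matrix q) (x2 (complex R))],
      forall t : tensor_alg (complex R) 2,
        nichols_pr (braiding_matrix q) t = 0 <->
        generated_ideal (serre_relations q) t
    & forall v : complex R, q = v ^+ 2 ->
        exists f : {lrmorphism nichols_alg (braiding_matrix q) -> Uplus v},
          [/\ bijective f,
              f (nichols_pr (braiding_matrix q) (x1 (complex R))) =
                Uplus_pr v (x1 (complex R))
            & f (nichols_pr (braiding_matrix q) (x2 (complex R))) =
                Uplus_pr v (x2 (complex R))]].
Proof.
have NS := nichols_sub_serre q_neq0 q_not_root_of_unity.
have SN := serre_sub_nichols q_neq0.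
split.
- exact: nichols_generated.
- move=> t; split=> [/alg_pr_eq0|] ; first exact: NS.
  by move=> St; apply/alg_pr_eq0; exact: SN.
move=> v qv; subst q.
exists (quot_map (I := nichols_proper_ideal _) (I' := serre_proper_ideal _) NS).
split; [refine (quot_map_bij (I := nichols_proper_ideal _) (I' := serre_proper_ideal _) NS SN)
  |exact: quot_map_pr|exact: quot_map_pr].
Qed.
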